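(* The process $\beta$ is a Markov process with respect to the filtration $\mathbb F^\beta$, i.e., $$\mathbf E\left[g(\beta_u)\,|\,\mathcal F^\beta_t\right]=\mathbf E\left[g(\beta_u)\,|\,\beta_t\right],\quad\mathbf P\text{-a.s.},$$ for all $0\le t<u$ and all measurable functions $g:\mathbb R\to\mathbb R$ such that $g(\beta_u)$ is integrable.
   Context: Setting. $(\Omega,\mathcal F,\mathbf P)$ is a complete probability space and $\mathcal N_P$ is the collection of its $\mathbf P$-null sets. $W=(W_t)_{t\ge0}$ is a standard Brownian motion with continuous paths starting from $0$. $\tau:\Omega\to(0,\infty)$ is a strictly positive random variable. It is assumed throughout that $\tau$ and $W$ are independent and that $\tau$ is not a stopping time of the completed natural filtration of $W$ (so $\tau$ is not a.s. equal to a constant). The information process is $\beta_t:=W_t-\frac{t}{\tau\vee t}W_{\tau\vee t}$, $t\ge0$. With $\mathcal F^0_t:=\sigma(\beta_s,\,0\le s\le t)$, the filtration $\mathbb F^\beta=(\mathcal F^\beta_t)_{t\ge0}$ is the smallest filtration containing $(\mathcal F^0_t)_{t\ge0}$ and satisfying the usual conditions of right-continuity and completeness: $$\mathcal F^\beta_t:=\sigma\Big(\bigcap_{u>t}\mathcal F^0_u\cup\mathcal N_P\Big),\quad t\ge0 .$$ *)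

(* Defs.v *)
From HB Require Import structures.
From mathcomp Require Import all_boot all_order all_algebra.
From mathcomp Require Import all_classical all_reals all_analysis measurable_realfun.

Set Implicit Arguments.
Unset Strict Implicit.
Unset Printing Implicit Defensive.

Import Order.TTheory GRing.Theory Num.Theory.
Import numFieldNormedType.Exports.

Local Open Scope classical_set_scope.
Local Open Scope ring_scope.

(* Throughout, processes are functions [R -> T -> R] whose values at negative
   times are irrelevant, and sub-sigma-algebras are systems of subsets of T. *)

Section conditional_expectation.
Context {R : realType} {d : measure_display} {T : measurableType d}
  (P : probability T R).

Definition is_condexp (G : set (set T)) (X Y : T -> R) :=
  [/\ g_sigma_algebra_preimage Y `<=` G,
      P.-integrable setT (EFin \o Y) &
      forall A, G A ->
        (\int[P]_(w in A) (Y w)%:E = \int[P]_(w in A) (X w)%:E)%E].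

(* An arbitrary version of E[X | G]; by [condexpP] the default value 0 is not
   used when X is integrable and G is a sub-sigma-algebra. *)
Definition condexp (G : set (set T)) (X : T -> R) : T -> R :=
  xget (cst 0) [set Y | is_condexp G X Y].

Lemma condexpP (G : set (set T)) (X : T -> R) :
  sigma_algebra setT G -> G `<=` measurable ->
  P.-integrable setT (EFin \o X) -> is_condexp G X (condexp G X).
Proof.
move=> sG Gm iX.
pose f : T -> g_sigma_algebraType G := id.
have mG : (measurable : set (set (g_sigma_algebraType G))) = G.
  exact: sigma_algebra_id.
have mf : measurable_fun setT f.
  by move=> _ A mA; rewrite setTI; apply: Gm; rewrite -mG.
pose F : {mfun T >-> g_sigma_algebraType G} := mfun_Sub (mem_set mf).
pose nu' : {charge set (g_sigma_algebraType G) -> \bar R} :=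
  pushforward (induced_charge iX) F.
pose nu := nu' (measurable_funPT F).
pose Q : probability (g_sigma_algebraType G) R := distribution P F.
have nuQ : nu `<< Q.
  apply: (@dominates_pushforward _ _ _ _ _ P (induced_charge iX) f) => //.
  apply/null_content_dominatesP => A mA PA; apply: null_set_integral => //.
  exact/measurable_funTS/(measurable_int P).
pose Y' := Radon_Nikodym nu Q.
have iY' : Q.-integrable setT Y' by exact: Radon_Nikodym_integrable.
have fY' w : Y' w \is a fin_num by exact: Radon_Nikodym_fin_num.
pose Y : T -> R := fun w => fine (Y' w).
have YE : EFin \o Y = Y' by apply/funext => w /=; rewrite fineK.
have mY' : measurable_fun setT Y' by exact: measurable_int iY'.
have mY'f : measurable_fun setT (Y' \o f) by exact: measurableT_comp mY' mf.
have iY : P.-integrable setT (EFin \o Y).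
  rewrite YE; apply/integrableP; split => //.
  move/integrableP : iY' => [_]; rewrite ge0_integral_pushforward//.
  exact: measurableT_comp.
suff : [set Y | is_condexp G X Y] Y by exact: xgetI.
split => //.
- move=> _ [B mB <-]; rewrite -mG.
  have mY : measurable_fun setT (fine \o Y') by exact: measurableT_comp.
  exact: mY.
- move=> A GA.
  have mA : measurable (A : set (g_sigma_algebraType G)) by rewrite mG.
  transitivity (nu A); last by [].
  rewrite (Radon_Nikodym_integral nuQ mA) integral_pushforward//.
    by apply: eq_integral => w _; rewrite /= fineK.
  have iYA : P.-integrable A Y'.
    by rewrite -YE; apply: integrableS iY => //; exact: Gm.
  exact: iYA.
Qed.

End conditional_expectation.

Section processes.
Context {R : realType} {d : measure_display} {T : measurableType d}
  (P : probability T R).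

Definition independent_systems (F G : set (set T)) :=
  forall A B, F A -> G B -> P (A `&` B) = (P A * P B)%E.

(* For a finite family the product rule over subfamilies is the instance
   [B i = setT] outside the subfamily. *)
Definition independent_RVs (n : nat) (X : 'I_n -> T -> R) :=
  forall B : 'I_n -> set R, (forall i, measurable (B i)) ->
    P (\bigcap_i (X i @^-1` B i)) = (\prod_(i < n) P (X i @^-1` B i))%E.

Record standard_brownian_motion (W : R -> T -> R) : Prop := {
  bm_measurable : forall t, 0 <= t -> measurable_fun setT (W t) ;
  bm_start : forall w, W 0 w = 0 ;
  bm_continuous : forall w, {within `[0, +oo[, continuous (W ^~ w)} ;
  (* the second parameter of [normal_prob] is the standard deviation *)
  bm_gaussian : forall s t, 0 <= s -> s < t -> forall B, measurable B ->
    P ((W t \- W s) @^-1` B) = normal_prob 0 (Num.sqrt (t - s)) B ;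
  bm_independent : forall (n : nat) (t : nat -> R),
    0 <= t 0%N -> nondecreasing_seq t ->
    independent_RVs (fun i : 'I_n => W (t i.+1) \- W (t i))
}.

Definition sigma_process (I : set R) (X : R -> T -> R) : set (set T) :=
  <<s \bigcup_(s in I) g_sigma_algebra_preimage (X s) >>.

Definition natural_filtration (X : R -> T -> R) (t : R) : set (set T) :=
  sigma_process `[0, t] X.

Definition completed_filtration (F : R -> set (set T)) (t : R) : set (set T) :=
  <<s F t `|` P.-negligible >>.

Definition usual_filtration (F : R -> set (set T)) (t : R) : set (set T) :=
  <<s (\bigcap_(u in [set u | t < u]) F u) `|` P.-negligible >>.

Definition stopping_time (F : R -> set (set T)) (tau : T -> R) :=
  forall t, 0 <= t -> F t [set w | tau w <= t].

End processes.

Definition information_process {R : realType} {T : Type}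
    (W : R -> T -> R) (tau : T -> R) (t : R) (w : T) : R :=
  W t w - t / Num.max (tau w) t * W (Num.max (tau w) t) w.

(* Main.v *)
(* Fix 0 < s < u.  Where beta_s <> 0 we have s < tau, and beta is there the
   bridge of W of length tau.  Then the ratios beta_r / r - beta_s / s with
   r <= s equal W_r / r - W_s / s, increments of the time-inverted Brownian
   motion: they are independent of tau, of W_s and of the motion after s.  As
   the history up to s is generated by these ratios and beta_s, only beta_s is
   informative, and the conditional law of beta_u is an explicit kernel k_s, a
   quotient of integrals of Gaussian densities.  Where beta_s = 0, almost surely
   tau <= s and beta stays at 0.

   To pass from F^0_s to the intersection of the F^0_v over v > t, take t > 0 and
   s decreasing to t: k_s(beta_s) converges almost surely to k_t(beta_t), and
   Fatou's lemma on A and on its complement identifies the limit.  At t = 0 one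
   shows instead that the intersection is independent of beta_u: the law of
   beta_s given (beta_u, tau) is asymptotic in total variation to the centred
   normal law of variance s, whatever (beta_u, tau).

   Negligible sets do not change integrals, so the kernel evaluated at beta_t is
   a version of the conditional expectation for both sigma-algebras. *)
Require Import Defs.
From mathcomp Require Import all_boot all_order all_algebra.
From mathcomp Require Import all_classical all_reals all_analysis measurable_realfun.
From mathcomp Require Import ring lra.
Import Order.TTheory GRing.Theory Num.Theory.
Import numFieldNormedType.Exports.
Local Open Scope classical_set_scope.
Local Open Scope ring_scope.
Set Implicit Arguments.
Unset Strict Implicit.
Unset Printing Implicit Defensive.

(** The point 0 shapes the argument. Given [tau], the variance of [beta s] tends to 0 as [tau]
    decreases to [s], so the density of [beta s] may be infinite at 0. Away from 0 it is controlled
    by [gauss a x * |x| <= 1], a bound free of the variance. The kernel is therefore a quotient only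
    off 0, and the domination needed as [s] decreases to [t] rests on [|beta (s_ n)|] staying above
    [|beta t| / 2]. Since [beta 0] vanishes, no such bound exists at [t = 0], whence the separate
    argument there.

    One formula serves both positions of [tau] relative to [u]: for [s < tau], the residual
    [beta s - s / u * beta u] is the value at [s] of a bridge of length [min u tau], independent of
    [beta u] once [tau] is frozen. If [tau <= s] the same formula yields a nonpositive variance,
    where [gauss] is 0, so the indicator of [s < tau] is built into the density.

    Independence of the inverted increments from [W s] needs no multivariate normal law: one
    regression of a Gaussian variable on a sum is iterated down a sorted list of times. All
    estimates concern nonnegative [g]; a general [g] is split into positive and negative parts only
    when the conditional expectation is formed. *)

Section sigma_algebras.
Context {d} {T : measurableType d}.
Implicit Types (C F G : set (set T)).

Lemma sub_g_sigma_measurable C : C `<=` measurable -> <<s C >> `<=` measurable.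
Proof. by move=> Cm; apply: smallest_sub => //; exact: sigma_algebra_measurable. Qed.

Lemma sub_sigma_setI C A B : <<s C >> A -> <<s C >> B -> <<s C >> (A `&` B).
Proof. exact: (@measurableI _ (g_sigma_algebraType C)). Qed.

Lemma sub_sigma_setT C : <<s C >> setT.
Proof. exact: (@measurableT _ (g_sigma_algebraType C)). Qed.

Lemma sigma_algebra_preimage_RV d' (U : measurableType d') (X : T -> U) :
  sigma_algebra setT (g_sigma_algebra_preimage X).
Proof. exact: (sigma_algebra_preimage _ _ (@sigma_algebra_measurable _ U)). Qed.

Lemma sub_preimage_measurable d' (U : measurableType d') (X : T -> U) :
  measurable_fun setT X -> g_sigma_algebra_preimage X `<=` measurable.
Proof. by move=> mX _ [B mB <-]; exact: mX. Qed.

(** Inclusions between generated sigma-algebras are proved below through this equivalence, by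
    closure of measurable functions under arithmetic. *)
Lemma measurable_g_sigmaP d' (U : measurableType d') C (X : T -> U) :
  measurable_fun setT (X : g_sigma_algebraType C -> U) <->
  g_sigma_algebra_preimage X `<=` <<s C >>.
Proof.
split=> [mX _ [B mB <-]|sX _ B mB]; first exact: (mX measurableT B mB).
by apply: sX; exists B.
Qed.

(** The identity into [T] with fewer measurable sets is a random element that carries a whole
    sub-sigma-algebra, so independence from it becomes independence of two random elements. *)
Lemma measurable_id_g_sigma C : C `<=` measurable ->
  measurable_fun setT (id : T -> g_sigma_algebraType C).
Proof. by move=> Cm _ B mB; rewrite setTI; exact: (sub_g_sigma_measurable Cm mB). Qed.

End sigma_algebras.

(** * Dynkin classes and independence of sigma-algebras *)

Section pi_lambda.
Context {R : realType} {d} {T : measurableType d}.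

(** The sets on which the integrals agree form a Dynkin class; stability under complement uses
    agreement on [setT], and integrability makes the subtraction legitimate. *)
Lemma integral_eq_g_sigma (P : {finite_measure set T -> \bar R})
    (C : set (set T)) (f1 f2 : T -> \bar R) :
  setI_closed C -> C setT -> C `<=` measurable ->
  P.-integrable setT f1 -> P.-integrable setT f2 ->
  (forall A, C A -> (\int[P]_(w in A) f1 w = \int[P]_(w in A) f2 w)%E) ->
  forall A, <<s C >> A -> (\int[P]_(w in A) f1 w = \int[P]_(w in A) f2 w)%E.
Proof.
move=> CI CT Cm if1 if2 f12.
pose H := [set A | d.-measurable A /\
  (\int[P]_(w in A) f1 w = \int[P]_(w in A) f2 w)%E].
suff CH : <<s C >> `<=` H by move=> A /CH[].
have DH : dynkin H.
  split.
  - by split => //; exact: f12.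
  - move=> A [mA e]; split; first exact: measurableC.
    have split_int f : P.-integrable setT f ->
        (\int[P]_(w in ~` A) f w = \int[P]_w f w - \int[P]_(w in A) f w)%E.
      move=> iF; rewrite -(setUv A) integral_setU//.
      - rewrite addeAC subee ?add0e//; apply: integrable_fin_num => //.
        exact: integrableS iF.
      - exact: measurableC.
      - by rewrite setUv; exact: (measurable_int _ iF).
      - by rewrite disj_set2E setICr.
    by rewrite !split_int// e f12.
  - move=> F tF HF; have mF n : measurable (F n) by have [] := HF n.
    have mU : measurable (\bigcup_k F k) by exact: bigcup_measurable.
    split => //.
    rewrite !integral_bigcup//; [|exact: integrableS if2|exact: integrableS if1].
    by apply: eq_eseriesr => k _; have [] := HF k.
rewrite -setI_closed_g_dynkin_g_sigma_algebra//; apply: smallest_sub => // A CA.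
by split; [exact: Cm|exact: f12].
Qed.

End pi_lambda.

Section independence.
Context {R : realType} {d} {T : measurableType d} (P : probability T R).
Implicit Types (C F G K : set (set T)).

Lemma independent_systemsC F G :
  independent_systems P F G -> independent_systems P G F.
Proof. by move=> FG A B GA FB; rewrite setIC muleC; exact: FG. Qed.

Lemma independent_systemsS F F' G G' : F' `<=` F -> G' `<=` G ->
  independent_systems P F G -> independent_systems P F' G'.
Proof. by move=> FF GG FG A B /FF FA /GG GB; exact: FG. Qed.

(** For fixed [B], both sides are integrals over [A]: of the indicator of [B], and of the constant
    [P B]. Agreement on a pi-system then suffices. *)
Lemma independent_systems_g_sigma C G :
  setI_closed C -> C setT -> C `<=` measurable -> G `<=` measurable ->
  independent_systems P C G -> independent_systems P <<s C >> G.
Proof.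
move=> CI CT Cm Gm CG A B CA GB.
have mB := Gm _ GB; have mA := sub_g_sigma_measurable Cm CA.
have intB A' : measurable A' ->
    (\int[P]_(w in A') (\1_B w)%:E = P (A' `&` B))%E.
  by move=> mA'; rewrite integral_indic// setIC.
have cstE A' : measurable A' ->
    (\int[P]_(w in A') cst (fine (P B))%:E w = P A' * P B)%E.
  by move=> mA'; rewrite integral_cst// fineK ?fin_num_measure// muleC.
rewrite -intB// -cstE//; apply: (integral_eq_g_sigma CI CT Cm) => //.
- apply: le_integrable (finite_measure_integrable_cst P 1 measurableT) => //.
    by apply/measurable_EFinP; exact: measurable_indic.
  by move=> w _; rewrite !lee_fin normr1 ger0_norm// indicE lern1.
- exact: finite_measure_integrable_cst.
- by move=> A' CA'; rewrite intB ?cstE//; [exact: CG|exact: Cm|exact: Cm].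
Qed.

(** The intersections of a set of [F] with a set of [G] form a pi-system generating the join. *)
Lemma independent_systems_join F G K :
  sigma_algebra setT F -> sigma_algebra setT G ->
  F `<=` measurable -> G `<=` measurable -> K `<=` measurable ->
  (forall A B D, F A -> G B -> K D ->
     P (A `&` B `&` D) = (P (A `&` B) * P D)%E) ->
  independent_systems P <<s F `|` G >> K.
Proof.
move=> sF sG Fm Gm Km FGK.
have Ft : F setT by case: sF => F0 FC _; rewrite -(setD0 setT); exact: FC.
have Gt : G setT by case: sG => G0 GC _; rewrite -(setD0 setT); exact: GC.
pose C := [set A `&` B | A in F & B in G].
have CI : setI_closed C.
  move=> _ _ [A FA [B GB <-]] [A' FA' [B' GB' <-]].
  exists (A `&` A').
    by rewrite -(sigma_algebra_id sF); apply: sub_sigma_setI; exact: sub_sigma_algebra.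
  exists (B `&` B'); last by rewrite setIACA.
  by rewrite -(sigma_algebra_id sG); apply: sub_sigma_setI; exact: sub_sigma_algebra.
apply: (@independent_systemsS <<s C >> _ K K) => //.
  apply: smallest_sub; first exact: smallest_sigma_algebra.
  move=> A [FA|GA]; apply: sub_sigma_algebra.
    by exists A => //; exists setT => //; rewrite setIT.
  by exists setT => //; exists A => //; rewrite setTI.
apply: independent_systems_g_sigma => //.
- by exists setT => //; exists setT => //; rewrite setTI.
- by move=> _ [A FA [B GB <-]]; apply: measurableI; [exact: Fm|exact: Gm].
- by move=> _ D [A FA [B GB <-]] KD; exact: FGK.
Qed.

Lemma sub_sigma_process (I : set R) (X : R -> T -> R) s : I s ->
  g_sigma_algebra_preimage (X s) `<=` sigma_process I X.
Proof. by move=> Is A XA; apply: sub_sigma_algebra; exists s. Qed.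

Lemma sigma_process_sub (I : set R) (X : R -> T -> R) F :
  sigma_algebra setT F -> (forall s, I s -> g_sigma_algebra_preimage (X s) `<=` F) ->
  sigma_process I X `<=` F.
Proof. by move=> sF sX; apply: smallest_sub => // A [s Is XA]; exact: sX XA. Qed.

Lemma sigma_process_measurable (I : set R) (X : R -> T -> R) :
  (forall s, I s -> measurable_fun setT (X s)) ->
  sigma_process I X `<=` measurable.
Proof.
move=> mX; apply: sigma_process_sub => [|s Is].
  exact: sigma_algebra_measurable.
exact/sub_preimage_measurable/mX.
Qed.

Lemma sigma_processS (I J : set R) (X : R -> T -> R) : I `<=` J ->
  sigma_process I X `<=` sigma_process J X.
Proof.
move=> IJ; apply: sigma_process_sub => [|s Is]; first exact: smallest_sigma_algebra.
exact: (sub_sigma_process (IJ _ Is)).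
Qed.

(** The events depending on finitely many times form a pi-system, because two lists of times can be
    concatenated. *)
Lemma independent_sigma_process (I : set R) (X : R -> T -> R) G :
  (forall s, I s -> measurable_fun setT (X s)) -> G `<=` measurable ->
  (forall ts : seq R, (forall s, s \in ts -> I s) ->
     independent_systems P (sigma_process [set` ts] X) G) ->
  independent_systems P (sigma_process I X) G.
Proof.
move=> mX Gm XG.
pose C := \bigcup_(ts in [set ts : seq R | forall s, s \in ts -> I s])
  sigma_process [set` ts] X.
apply: (@independent_systemsS <<s C >> _ G G) => //.
  apply: sigma_process_sub => [|s Is A XA]; first exact: smallest_sigma_algebra.
  apply: sub_sigma_algebra; exists [:: s].
    by move=> r /=; rewrite inE => /eqP ->.
  by apply: (sub_sigma_process _ XA); rewrite /= inE.
apply: independent_systems_g_sigma => //.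
- move=> A B [ts Its tsA] [ss Iss ssB]; exists (ts ++ ss).
    by move=> r; rewrite mem_cat => /orP[/Its|/Iss].
  apply: sub_sigma_setI.
    by apply: sigma_processS tsA => r /= rt; rewrite mem_cat rt.
  by apply: sigma_processS ssB => r /= rt; rewrite mem_cat rt orbT.
- by exists [::] => //; exact: sub_sigma_setT.
- move=> A [ts Its tsA]; apply: sigma_process_measurable tsA => s /= st.
  exact/mX/Its.
- by move=> A B [ts Its tsA] GB; exact: (XG ts).
Qed.

(** Independence identifies the joint law with the product of the marginals; Tonelli's theorem then
    gives the iterated integral. This is how one argument is frozen in what follows. *)
Lemma independent_integral d1 (T1 : measurableType d1) d2 (T2 : measurableType d2)
    (f1 : T -> T1) (f2 : T -> T2) (h : T1 * T2 -> \bar R) :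
  measurable_fun setT f1 -> measurable_fun setT f2 ->
  independent_systems P (g_sigma_algebra_preimage f1) (g_sigma_algebra_preimage f2) ->
  measurable_fun setT h -> (forall z, (0 <= h z)%E) ->
  (\int[P]_w h (f1 w, f2 w) = \int[P]_w \int[P]_w' h (f1 w, f2 w'))%E.
Proof.
move=> mf1 mf2 f12 mh h0.
pose m1 := distribution P (mfun_Sub (mem_set mf1) : {mfun T >-> T1}).
pose m2 := distribution P (mfun_Sub (mem_set mf2) : {mfun T >-> T2}).
pose f12' w := (f1 w, f2 w).
have mf : measurable_fun setT f12' by exact: measurable_fun_pair.
pose m := distribution P (mfun_Sub (mem_set mf) : {mfun T >-> (T1 * T2)%type}).
have mE X : measurable X -> (m1 \x m2)%E X = m X.
  apply: product_measure_unique => A B mA mB; rewrite /m /m1 /m2 /=.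
  rewrite /distribution /pushforward.
  rewrite -[RHS]f12; last 2 first.
  - by exists A => //; rewrite setTI.
  - by exists B => //; rewrite setTI.
  by congr (P _).
have -> : (\int[P]_w h (f1 w, f2 w) = \int[m]_z h z)%E.
  by rewrite /m/= ge0_integral_pushforward.
rewrite (eq_measure_integral (m1 \x m2)%E); last by move=> A mA _; exact/esym/mE.
rewrite fubini_tonelli1// /m1/= ge0_integral_pushforward//=.
- apply: eq_integral => w _ /=.
  rewrite /fubini_F /m2/= ge0_integral_pushforward//=.
  exact: measurableT_comp.
- exact: measurable_fun_fubini_tonelli_F.
- by move=> y _; exact: integral_ge0.
Qed.

End independence.

(** * Gaussian densities and their bounds *)

Section gauss_density.
Context {R : realType}.
Implicit Types a b x y : R.
Local Notation mu := (@lebesgue_measure R).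

(** The image of Lebesgue measure under a translation agrees with it on half-open intervals, hence
    everywhere. *)
Lemma ge0_integral_shift (f : R -> \bar R) c :
  measurable_fun setT f -> (forall x, (0 <= f x)%E) ->
  (\int[mu]_x f (x + c)%R = \int[mu]_x f x)%E.
Proof.
move=> mf f0.
pose RT := measurableTypeR R.
have mc : measurable_fun setT ((fun x : R => x + c) : RT -> RT).
  by apply: measurable_funD; [exact: measurable_id|exact: measurable_cst].
pose F := MeasurableFun.Pack (MeasurableFun.Class (isMeasurableFun.Build _ _ _ _ _ mc)).
transitivity (\int[pushforward mu F]_x f x)%E.
  by rewrite ge0_integral_pushforward.
apply: (eq_measure_integral mu) => A mA _; apply/esym.
apply: lebesgue_measure_unique => // _ [[u v] /= _ <-].
rewrite /pushforward /F /=.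
rewrite (_ : _ @^-1` _ = `]u - c, v - c]%classic); last first.
  by apply/seteqP; split => x /=; rewrite !in_itv/= ltrBlDr lerBrDr.
by rewrite !lebesgue_measure_itv/= !lte_fin ltrD2r; case: ifPn => // _; rewrite -!EFinB; congr EFin; ring.
Qed.

(* The density of the centred normal law of variance [a], and [0] when [a <= 0]. *)
Definition gauss a x : R := if 0 < a then normal_pdf 0 (Num.sqrt a) x else 0.

Lemma gaussE a x : 0 < a ->
  gauss a x = (Num.sqrt (a * pi *+ 2))^-1 * expR (- (x ^+ 2 / (a *+ 2))).
Proof.
move=> a0; rewrite /gauss a0 normal_pdfE ?gt_eqF ?sqrtr_gt0//.
by rewrite /normal_peak /normal_fun sqr_sqrtr ?ltW// subr0 mulNr.
Qed.

Lemma gauss_ge0 a x : 0 <= gauss a x.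
Proof. by rewrite /gauss; case: ifP => // _; exact: normal_pdf_ge0. Qed.

Lemma gauss_gt0 a x : 0 < a -> 0 < gauss a x.
Proof.
move=> a0; rewrite gaussE// mulr_gt0 ?expR_gt0// invr_gt0 sqrtr_gt0 pmulrn_lgt0//.
by rewrite mulr_gt0// pi_gt0.
Qed.

Lemma gauss_le0 a x : a <= 0 -> gauss a x = 0.
Proof. by rewrite leNgt /gauss => /negbTE ->. Qed.

(** Measurability is needed jointly in the variance and the point, because the variance will depend
    on [tau]. Inverses and square roots are rewritten as real powers. *)
Lemma measurable_gauss2 : measurable_fun setT (fun z : R * R => gauss z.1 z.2).
Proof.
have -> : (fun z : R * R => gauss z.1 z.2) = (fun z => if 0 < z.1 then
    (Num.sqrt (pi *+ 2))^-1 * (z.1 `^ (- 2^-1)) *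
    expR (- (z.2 ^+ 2 * (z.1 `^ (-1) * 2^-1))) else 0).
  apply/funext => -[a x]/=; case: ifPn => a0; last by rewrite gauss_le0// leNgt.
  rewrite gaussE//; congr (_ * expR (- (_ * _))).
    rewrite powRN powR12_sqrt ?ltW// -mulrnAr sqrtrM ?ltW// invfM mulrC//.
  by rewrite powRN powRr1 ?ltW// -invfM mulr_natr.
apply: measurable_fun_ifT => //.
  exact: (measurable_fun_ltr (measurable_cst _) measurable_fst).
apply: measurable_funM.
  apply: measurable_funM => //.
  exact: (measurableT_comp (measurable_powR _) measurable_fst).
apply: measurableT_comp => //; apply: measurableT_comp => //.
apply: measurable_funM; first by apply: measurable_funX; exact: measurable_snd.
apply: measurable_funM => //.
exact: (measurableT_comp (measurable_powR _) measurable_fst).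
Qed.

Lemma measurable_gauss d (T : measurableType d) (a x : T -> R) :
  measurable_fun setT a -> measurable_fun setT x ->
  measurable_fun setT (fun w => gauss (a w) (x w)).
Proof.
by move=> ma mx; apply: (measurableT_comp measurable_gauss2 (measurable_fun_pair ma mx)).
Qed.

Lemma integral_gauss a c : 0 < a -> (\int[mu]_x (gauss a (x + c)%R)%:E = 1)%E.
Proof.
move=> a0; rewrite (@ge0_integral_shift (fun x => (gauss a x)%:E)).
- rewrite /gauss a0; exact: integral_normal_pdf.
- by apply/measurable_EFinP; apply: measurable_gauss.
- by move=> x; rewrite lee_fin gauss_ge0.
Qed.

Lemma normal_prob_gauss a A : 0 < a ->
  (normal_prob 0 (Num.sqrt a) A = \int[mu]_(x in A) (gauss a x)%:E)%E.
Proof. by move=> a0; rewrite /normal_prob /gauss a0. Qed.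

Lemma gauss_le_exp a x : 0 < a ->
  gauss a x <= (Num.sqrt a)^-1 * expR (- (x ^+ 2 / (a *+ 2))).
Proof.
move=> a0; rewrite gaussE//; apply: ler_wpM2r; first exact: expR_ge0.
have pi2 : 2 <= pi *+ 2 :> R.
  by rewrite -[leLHS]/(1 *+ 2) lerMn2r/= (le_trans _ (pi_ge2 R))// ler1n.
have pia : 0 < a * (pi *+ 2) by rewrite mulr_gt0//; lra.
rewrite lef_pV2 ?posrE ?sqrtr_gt0 -?mulrnAr//.
have h : a <= a * (pi *+ 2) by rewrite ler_peMr ?(ltW a0)//; lra.
by rewrite ler_sqrt// ltW.
Qed.

Lemma gauss_ub a x : 0 < a -> gauss a x <= (Num.sqrt a)^-1.
Proof.
move=> a0; apply: le_trans (gauss_le_exp x a0) _.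
rewrite ler_piMr ?invr_ge0 ?sqrtr_ge0//.
by rewrite -[leRHS]expR0 ler_expR oppr_le0 divr_ge0 ?sqr_ge0// mulrn_wge0// ltW.
Qed.

(** With [y = |x| / sqrt a] the claim reduces to [y <= expR (y ^+ 2 / 2)], which follows from
    [y <= 1 + y ^+ 2 / 2]. The bound is uniform in the variance. *)
Lemma gauss_ub_norm a x : gauss a x * `|x| <= 1.
Proof.
have [a0|a0] := ltP 0 a; last by rewrite gauss_le0// mul0r.
have sa : 0 < Num.sqrt a by rewrite sqrtr_gt0.
apply: le_trans (ler_wpM2r (normr_ge0 x) (gauss_le_exp x a0)) _.
rewrite -mulrAC mulrC [_^-1 * _]mulrC; set y := `|x| / Num.sqrt a.
have y0 : 0 <= y by rewrite divr_ge0// ltW.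
rewrite expRN mulrC ler_pdivrMr ?expR_gt0// mul1r.
apply: le_trans (expR_ge1Dx _).
have -> : x ^+ 2 / (a *+ 2) = y ^+ 2 / 2.
  rewrite /y exprMn exprVn sqr_sqrtr ?ltW// real_normK ?num_real//.
  by rewrite -[a *+ 2]mulr_natr invfM mulrA.
by have := sqr_ge0 (y - 1); nra.
Qed.

(* The joint density of two independent centred Gaussians, in the coordinates
   given by their sum [w] and the residual of the regression of the first on it. *)
Lemma gauss_mul a b x w : 0 < a -> 0 < b ->
  gauss a x * gauss b (w - x) =
  gauss (a * b / (a + b)) (x - a / (a + b) * w) * gauss (a + b) w.
Proof.
move=> a0 b0; have t0 : 0 < a + b by rewrite addr_gt0.
have c0 : 0 < a * b / (a + b) by rewrite divr_gt0// mulr_gt0.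
rewrite !gaussE// !mulrA.
have p0 := pi_gt0 R.
rewrite [LHS](_ : _ = ((Num.sqrt (a * pi *+ 2))^-1 * (Num.sqrt (b * pi *+ 2))^-1) *
  (expR (- (x ^+ 2 / (a *+ 2))) * expR (- ((w - x) ^+ 2 / (b *+ 2))))); last by ring.
rewrite [RHS](_ : _ = ((Num.sqrt (a * b / (a + b) * pi *+ 2))^-1 *
   (Num.sqrt ((a + b) * pi *+ 2))^-1) *
  (expR (- ((x - a / (a + b) * w) ^+ 2 / (a * b / (a + b) *+ 2))) *
   expR (- (w ^+ 2 / ((a + b) *+ 2))))); last by ring.
rewrite -!expRD -!invfM -!sqrtrM ?mulrn_wge0 ?mulr_ge0 ?ltW ?invr_gt0//.
congr ((Num.sqrt _)^-1 * expR _); field; first by rewrite gt_eqF.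
by rewrite !gt_eqF.
Qed.

Lemma cvg_gauss (u v : nat -> R) a x : 0 < a ->
  u n @[n --> \oo] --> a -> v n @[n --> \oo] --> x ->
  gauss (u n) (v n) @[n --> \oo] --> gauss a x.
Proof.
move=> a0 ua vx; rewrite gaussE//.
have h : (Num.sqrt (u n * pi *+ 2))^-1 * expR (- (v n ^+ 2 / (u n *+ 2))) @[n --> \oo]
   --> (Num.sqrt (a * pi *+ 2))^-1 * expR (- (x ^+ 2 / (a *+ 2))).
  apply: cvgM.
    apply: cvgV.
      by rewrite gt_eqF// sqrtr_gt0 pmulrn_lgt0// mulr_gt0// pi_gt0.
    apply: (@cvg_comp _ _ _ (fun n => u n * pi *+ 2) Num.sqrt); last exact: sqrt_continuous.
    by apply: cvgMn; apply: cvgMl.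
  apply: (@cvg_comp _ _ _ (fun n => - (v n ^+ 2 / (u n *+ 2))) expR); last exact: continuous_expR.
  apply: cvgN; apply: cvgM.
    exact: (cvgM vx vx).
  apply: cvgV; first by rewrite gt_eqF// pmulrn_lgt0.
  exact: cvgMn.
apply: cvg_trans h; apply: near_eq_cvg; near=> n.
rewrite gaussE//; near: n; exact: (cvgr_gt _ ua).
Unshelve. all: by end_near. Qed.

End gauss_density.

Section integral_density.
Context {d} {T : measurableType d} {R : realType}.
Variables (m1 m2 : {measure set T -> \bar R}) (f : T -> R).
Hypothesis mf : measurable_fun setT f.
Hypothesis f0 : forall x, 0 <= f x.
Hypothesis m1E : forall A, measurable A -> (m1 A = \int[m2]_(x in A) (f x)%:E)%E.
Local Open Scope ereal_scope.
Import HBNNSimple.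

(** The hypothesis is the case of indicators; simple functions follow by linearity and general ones
    by monotone convergence. *)
Lemma ge0_integral_density (h : T -> \bar R) :
  measurable_fun setT h -> (forall x, 0 <= h x) ->
  \int[m1]_x h x = \int[m2]_x (h x * (f x)%:E).
Proof.
move=> mh h0; pose g := nnsfun_approx measurableT mh.
have mEf : measurable_fun setT (EFin \o f) by exact/measurable_EFinP.
have gh x : (g n x)%:E @[n --> \oo] --> h x by exact: cvg_nnsfun_approx.
have gf (k : {nnsfun T >-> R}) :
    \int[m1]_x (k x)%:E = \int[m2]_x ((k x)%:E * (f x)%:E).
  rewrite integralT_nnsfun sintegralE.
  transitivity (\int[m2]_x (\sum_(y \in range k)
      (y%:E * ((\1_(k @^-1` [set y]) x)%:E * (f x)%:E)))); last first.
    apply: eq_integral => x _; rewrite [in RHS]fimfunE -fsumEFin// ge0_mule_fsuml.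
      by apply: eq_fsbigr => y _; rewrite EFinM muleA.
    by move=> y; rewrite EFinM; exact: nnfun_muleindic_ge0.
  rewrite ge0_integral_fsum//.
  - apply: eq_fsbigr => y; rewrite inE => -[t _ <-].
    rewrite ge0_integralZl//.
    + rewrite m1E//; congr (_ * _); rewrite integral_mkcond.
      by apply: eq_integral => x _; rewrite epatch_indic muleC.
    + by apply: emeasurable_funM => //; exact/measurable_EFinP.
    + by move=> x _; rewrite mule_ge0 ?lee_fin.
    + by rewrite lee_fin.
  - move=> y; apply: emeasurable_funM => //; apply: emeasurable_funM => //.
    exact/measurable_EFinP.
  - move=> y x _; rewrite muleA; apply: mule_ge0; last by rewrite lee_fin.
    by rewrite -EFinM nnfun_muleindic_ge0.
transitivity (limn (fun n => \int[m1]_x (g n x)%:E)).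
  rewrite -monotone_convergence//.
  - by apply: eq_integral => x _; apply/esym/cvg_lim.
  - by move=> n; apply/measurable_EFinP.
  - by move=> n x _; rewrite lee_fin.
  - by move=> x _ a b ab; rewrite lee_fin; exact/lefP/nd_nnsfun_approx.
under eq_fun do rewrite gf.
rewrite -monotone_convergence//.
- apply: eq_integral => x _; apply/cvg_lim => //.
  by apply: cvgeZr.
- by move=> n; apply: emeasurable_funM => //; exact/measurable_EFinP.
- by move=> n x _; rewrite mule_ge0 ?lee_fin.
- move=> x _ a b ab; rewrite lee_wpmul2r ?lee_fin//.
  exact/lefP/nd_nnsfun_approx.
Qed.

End integral_density.

(** * Gaussian variables and linear regression *)

Section gaussian_RVs.
Context {R : realType} {d} {T : measurableType d} (P : probability T R).
Local Notation mu := (@lebesgue_measure R).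

Definition gaussian_RV (a : R) (X : T -> R) :=
  forall B, measurable B -> (P (X @^-1` B) = \int[mu]_(x in B) (gauss a x)%:E)%E.

Lemma gaussian_integral a (X : T -> R) (h : R -> \bar R) :
  measurable_fun setT X -> gaussian_RV a X ->
  measurable_fun setT h -> (forall x, (0 <= h x)%E) ->
  (\int[P]_w h (X w) = \int[mu]_x (h x * (gauss a x)%:E))%E.
Proof.
move=> mX lX mh h0.
pose RT := measurableTypeR R.
have mX' : measurable_fun setT (X : T -> RT) by exact: mX.
pose F := MeasurableFun.Pack (MeasurableFun.Class (isMeasurableFun.Build _ _ _ _ _ mX')).
transitivity (\int[pushforward P F]_x h x)%E.
  by rewrite ge0_integral_pushforward.
apply: (ge0_integral_density (m1 := pushforward P F) (m2 := mu) (f := gauss a)) => //.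
- exact: measurable_gauss.
- exact: gauss_ge0.
Qed.

Lemma independent_gaussian_integral (F : set (set T)) a (X : T -> R)
    (h : T * R -> \bar R) :
  F `<=` measurable -> measurable_fun setT X -> gaussian_RV a X ->
  independent_systems P <<s F >> (g_sigma_algebra_preimage X) ->
  measurable_fun setT (h : g_sigma_algebraType F * R -> \bar R) ->
  (forall z, (0 <= h z)%E) ->
  (\int[P]_w h (w, X w) = \int[P]_w \int[mu]_x (h (w, x) * (gauss a x)%:E))%E.
Proof.
move=> Fm mX lX FX mh h0.
rewrite (@independent_integral _ _ _ P _ (g_sigma_algebraType F) _ R id X h) => //.
- apply: eq_integral => w _; apply: (gaussian_integral (h := fun x => h (w, x))) => //.
  exact: (measurableT_comp mh (measurable_pair1 _)).
- exact: measurable_id_g_sigma.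
- move=> A B [A' FA' <-]; rewrite setTI; exact: FX.
Qed.

(** The three events are mutually independent: the past [E], the residual of [X] on [X + Y], and the
    sum itself. Integrating out [Y] and then [X] leaves a double integral, in which the translation
    [y = w - x] turns the product of densities into the factorised form of [gauss_mul]. *)
Lemma gaussian_regression (F : set (set T)) a b (X Y : T -> R) :
  0 < a -> 0 < b -> F `<=` measurable ->
  measurable_fun setT X -> measurable_fun setT Y ->
  gaussian_RV a X -> gaussian_RV b Y ->
  independent_systems P <<s F >> (g_sigma_algebra_preimage X) ->
  independent_systems P <<s F `|` g_sigma_algebra_preimage X >>
                        (g_sigma_algebra_preimage Y) ->
  forall E C1 C2, <<s F >> E -> measurable C1 -> measurable C2 ->
    (P (E `&` (fun w => X w - a / (a + b) * (X w + Y w))%R @^-1` C1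
          `&` (fun w => X w + Y w)%R @^-1` C2) =
     P E * \int[mu]_(x in C1) (gauss (a * b / (a + b))%R x)%:E
         * \int[mu]_(x in C2) (gauss (a + b)%R x)%:E)%E.
Proof.
move=> a0 b0 Fm mX mY lX lY FX FXY E C1 C2 FE mC1 mC2.
have t0 : 0 < a + b by rewrite addr_gt0.
set c := a / (a + b); set v := a * b / (a + b).
have mE := sub_g_sigma_measurable Fm FE.
have mXm := sub_preimage_measurable mX.
pose k (x y : R) : R := \1_C1 (x - c * (x + y)) * \1_C2 (x + y).
have mk : measurable_fun setT (fun z : R * R => k z.1 z.2).
  apply: measurable_funM.
    apply: (measurableT_comp (measurable_indic mC1)); apply: measurable_funB => //.
    by apply: measurable_funM => //; exact: measurable_funD.
  by apply: (measurableT_comp (measurable_indic mC2)); exact: measurable_funD.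
have k0 x y : 0 <= k x y by rewrite /k mulr_ge0.
transitivity (\int[P]_w ((\1_E w * k (X w) (Y w))%:E))%E.
  rewrite -[X in P X]setIT -integral_indic//; last first.
    have mS : measurable_fun setT (fun w => X w + Y w) by exact: measurable_funD.
    apply: measurableI; [apply: measurableI => //|].
      rewrite -[X in measurable X]setTI; apply: measurable_funB => //.
      exact: measurable_funM.
    by rewrite -[X in measurable X]setTI; exact: mS.
  apply: eq_integral => w _; rewrite /k !indicE !in_setI -!mulnb !natrM.
  by rewrite -mulrA.
pose F' := F `|` g_sigma_algebra_preimage X.
have F'm : F' `<=` measurable by rewrite subUset; split.
pose h1 (z : T * R) := (\1_E z.1 * k (X z.1) z.2)%:E.
rewrite (@independent_gaussian_integral F' b Y h1) => //; first last.
- by move=> z; rewrite lee_fin mulr_ge0.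
- have mX' : measurable_fun setT (X : g_sigma_algebraType F' -> R).
    apply/measurable_g_sigmaP => A XA; apply: sub_sigma_algebra; right; exact: XA.
  have mE' : measurable (E : set (g_sigma_algebraType F')).
    by apply: sub_smallest2r FE; [exact: smallest_sigma_algebra|move=> A; left].
  apply/measurable_EFinP; apply: measurable_funM.
    exact: (measurableT_comp (measurable_indic mE') measurable_fst).
  exact: (measurableT_comp mk
    (measurable_fun_pair (measurableT_comp mX' measurable_fst) measurable_snd)).
pose h2 (z : T * R) := ((\1_E z.1)%:E * \int[mu]_y ((k z.2 y)%:E * (gauss b y)%:E))%E.
have mkb : measurable_fun setT (fun z : R * R => ((k z.1 z.2)%:E * (gauss b z.2)%:E)%E).
  apply: emeasurable_funM; apply/measurable_EFinP => //.
  exact: measurable_gauss.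
have mkI : measurable_fun setT (fun x => \int[mu]_y ((k x y)%:E * (gauss b y)%:E))%E.
  apply: (measurable_fun_fubini_tonelli_F (m2 := mu)
    (fun z : R * R => ((k z.1 z.2)%:E * (gauss b z.2)%:E)%E)) => //.
  by move=> z; rewrite mule_ge0 ?lee_fin ?gauss_ge0.
have kI0 x : (0 <= \int[mu]_y ((k x y)%:E * (gauss b y)%:E))%E.
  by apply: integral_ge0 => y _; rewrite mule_ge0 ?lee_fin ?gauss_ge0.
transitivity (\int[P]_w h2 (w, X w))%E.
  apply: eq_integral => w _; rewrite /h1 /h2/= -ge0_integralZl//.
  - by apply: eq_integral => y _; rewrite EFinM muleA.
  - exact: (measurableT_comp mkb (measurable_pair1 (X w))).
  - by move=> y _; rewrite mule_ge0 ?lee_fin ?gauss_ge0.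
rewrite (@independent_gaussian_integral F a X h2) => //; first last.
- by move=> z; rewrite mule_ge0// lee_fin.
- apply: emeasurable_funM; last exact: (measurableT_comp mkI measurable_snd).
  have mE' : measurable (E : set (g_sigma_algebraType F)) by [].
  apply/measurable_EFinP.
  exact: (measurableT_comp (measurable_indic mE') measurable_fst).
pose J := (\int[mu]_x ((\int[mu]_y ((k x y)%:E * (gauss b y)%:E)) * (gauss a x)%:E))%E.
transitivity (\int[P]_w ((\1_E w)%:E * J))%E.
  apply: eq_integral => w _; rewrite /h2/=.
  apply: etrans; last apply: ge0_integralZl.
  - by apply: eq_integral => y _; rewrite muleA.
  - exact: measurableT.
  - by apply: emeasurable_funM => //; apply/measurable_EFinP; exact: measurable_gauss.
  - by move=> x _; rewrite mule_ge0 ?lee_fin ?gauss_ge0.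
  - by [].
rewrite ge0_integralZr//; last 2 first.
- by apply/measurable_EFinP; exact: measurable_indic.
- by apply: integral_ge0 => x _; rewrite mule_ge0 ?lee_fin ?gauss_ge0.
rewrite integral_indic// setIT -muleA; congr (_ * _)%E.
(* The integrand in the coordinates [x] and [w = x + y], with [c] the regression coefficient and [v]
   the variance of the residual. For fixed [w] a translation by [c * w] in [x] will separate the
   variables. *)
pose q (x w : R) : \bar R := ((\1_C1 (x - c * w) * \1_C2 w) * (gauss v (x - c * w) * gauss (a + b) w))%:E.
have mq : measurable_fun setT (fun z : R * R => q z.1 z.2).
  have ms : measurable_fun setT (fun z : R * R => z.1 - c * z.2).
    by apply: measurable_funB => //; apply: measurable_funM.
  apply/measurable_EFinP; apply: measurable_funM; apply: measurable_funM.
  - exact: (measurableT_comp (measurable_indic mC1)).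
  - exact: (measurableT_comp (measurable_indic mC2)).
  - exact: measurable_gauss.
  - exact: measurable_gauss.
have q0 x w : (0 <= q x w)%E by rewrite lee_fin !mulr_ge0 ?gauss_ge0.
transitivity (\int[mu]_x \int[mu]_w q x w)%E.
  apply: eq_integral => x _; rewrite -ge0_integralZr//; first last.
  - by rewrite lee_fin gauss_ge0.
  - by move=> y _; rewrite mule_ge0 ?lee_fin ?gauss_ge0.
  - exact: (measurableT_comp mkb (measurable_pair1 x)).
  rewrite -(@ge0_integral_shift _ (q x) x) => //; last first.
    exact: (measurableT_comp mq (measurable_pair1 x)).
  apply: eq_integral => y _; rewrite /q /v /c -gauss_mul// -!EFinM /k [y + x]addrC.
  by congr EFin; rewrite (_ : x + y - x = y); [ring|rewrite addrC addKr].
rewrite (fubini_tonelli (m1 := mu) (m2 := mu) (fun z : R * R => q z.1 z.2))//=.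
transitivity (\int[mu]_w ((\1_C2 w * gauss (a + b) w)%:E *
    \int[mu]_x (\1_C1 x * gauss v x)%:E))%E.
  apply: eq_integral => w _.
  have mr : measurable_fun setT (fun x : R => (\1_C1 x * gauss v x)%:E).
    apply/measurable_EFinP; apply: measurable_funM; first exact: measurable_indic.
    exact: measurable_gauss.
  have r0 x : (0 <= (\1_C1 x * gauss v x)%:E)%E.
    by rewrite lee_fin mulr_ge0 ?gauss_ge0.
  rewrite -(@ge0_integral_shift _ (fun x => (\1_C1 x * gauss v x)%:E) (- (c * w)) mr r0).
  rewrite -ge0_integralZl; [|exact: measurableT| |by []|].
  - apply: eq_integral => x _.
    by rewrite /q -EFinM [in RHS]mulrACA (mulrC (\1_C2 w)) (mulrC (gauss (a + b) w)).
  - by apply: (measurableT_comp mr); exact: measurable_funD.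
  - by rewrite lee_fin mulr_ge0 ?gauss_ge0.
have restr (C : set R) (s : R) : measurable C ->
    (\int[mu]_x (\1_C x * gauss s x)%:E = \int[mu]_(x in C) (gauss s x)%:E)%E.
  move=> mC; rewrite [RHS]integral_mkcond; apply: eq_integral => x _.
  by rewrite epatch_indic EFinM muleC.
rewrite ge0_integralZr//.
- by rewrite muleC; congr (_ * _)%E; exact: restr.
- apply/measurable_EFinP; apply: measurable_funM; first exact: measurable_indic.
  exact: measurable_gauss.
- by move=> x _; rewrite lee_fin mulr_ge0 ?gauss_ge0.
- by apply: integral_ge0 => x _; rewrite lee_fin mulr_ge0 ?gauss_ge0.
Qed.

End gaussian_RVs.

(** * Independence of Brownian increments from the past *)

Section brownian_increments.
Context {R : realType} {d} {T : measurableType d} (P : probability T R).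
Variables (W : R -> T -> R) (hW : standard_brownian_motion P W).

Let mW t : 0 <= t -> measurable_fun setT (W t).
Proof. exact: (bm_measurable hW). Qed.

Definition increment_rectangles (m : nat) (t : nat -> R) : set (set T) :=
  [set A | exists2 B : nat -> set R, (forall i, measurable (B i)) &
    A = \bigcap_(i in `I_m) (W (t i.+1) \- W (t i)) @^-1` B i].

Lemma independent_increment_rectangles m (t : nat -> R) :
  0 <= t 0%N -> nondecreasing_seq t ->
  independent_systems P <<s increment_rectangles m t >>
    (g_sigma_algebra_preimage (W (t m.+1) \- W (t m))).
Proof.
move=> t0 ndt; pose X i := W (t i.+1) \- W (t i).
have t_ge0 i : 0 <= t i by apply: le_trans t0 _; exact: ndt.
have mX i : measurable_fun setT (X i) by apply: measurable_funB; exact: mW.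
have mXB i B : measurable B -> measurable (X i @^-1` B).
  by move=> mB; rewrite -[X in measurable X]setTI; exact: mX.
have prodE k (B : nat -> set R) : (forall i, measurable (B i)) ->
    (P (\bigcap_(i in `I_k) X i @^-1` B i) = \prod_(i < k) P (X i @^-1` B i))%E.
  move=> mB; rewrite -(bm_independent hW t0 ndt (fun i => mB i)).
  congr (P _); apply/seteqP; split => [w h i _|w h i /= ik]; first exact: (h i (ltn_ord i)).
  exact: (h (Ordinal ik)).
apply: independent_systems_g_sigma.
- move=> _ _ [B mB ->] [B' mB' ->]; exists (fun i => B i `&` B' i).
    by move=> i; exact: measurableI.
  by rewrite -bigcapI.
- exists (fun=> setT) => //; apply/seteqP; split => //.
- move=> _ [B mB ->]; apply: bigcap_measurableType => k _; exact: mXB.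
- exact/sub_preimage_measurable/mX.
- move=> _ _ [B mB ->] [D mD <-]; rewrite setTI.
  (* The rectangle is prolonged by [D] at index [m], so that the product rule for [m.+1] increments
     splits off the last factor. *)
  pose B' i := if (i < m)%N then B i else D.
  have mB' i : measurable (B' i) by rewrite /B'; case: ifP.
  have -> : \bigcap_(i in `I_m) (W (t i.+1) \- W (t i)) @^-1` B i `&` X m @^-1` D =
      \bigcap_(i in `I_m.+1) X i @^-1` B' i.
    apply/seteqP; split => [w [h1 h2] i /=|w h].
      rewrite ltnS leq_eqVlt /B' => /orP[/eqP ->|im]; first by rewrite ltnn.
      by rewrite im; exact: h1.
    split; last by have := h m (ltnSn m); rewrite /B'/= ltnn.
    by move=> i /= im; have := h i (ltnW im); rewrite /B'/= im.
  rewrite !prodE// big_ord_recr/= /B' ltnn; congr (_ * _)%E.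
  by apply: eq_bigr => i _; rewrite ltn_ord.
Qed.

(** A finite list of times is turned into an increasing sequence whose first increments generate the
    values of [W] on the list and whose next increment is the future one. *)
Lemma independent_future_increment_seq (ts : seq R) a s :
  (forall r, r \in ts -> 0 <= r <= a) -> 0 <= a -> a < s ->
  independent_systems P (sigma_process [set` ts] W)
    (g_sigma_algebra_preimage (W s \- W a)).
Proof.
move=> tsa a0 as_.
(* The time 0 makes each [W (t i)] a sum of increments, since [W 0 = 0]; the time [a], the largest,
   makes the increment of index [m] start at [a]. *)
pose l := sort <=%R (0 :: a :: ts); pose m := (size ts).+1.
have szl : size l = m.+1 by rewrite size_sort.
have sl : sorted <=%R l by exact: sort_le_sorted.
have la r : r \in l -> 0 <= r <= a.
  rewrite mem_sort !inE => /orP[/eqP->|/orP[/eqP->|/tsa//]]; first by rewrite lexx.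
  by rewrite a0 lexx.
(* The default value [s] supplies all times from index [m.+1] on, which keeps the sequence
   nondecreasing. *)
pose t := nth s l.
have tl i : (i <= m)%N -> t i \in l by move=> im; rewrite mem_nth// szl ltnS.
have tlt i j : (i <= j <= m)%N -> t i <= t j.
  move=> /andP[ij jm]; apply: (sorted_leq_nth le_trans lexx s sl) => //.
    by rewrite inE szl ltnS (leq_trans ij).
  by rewrite inE szl ltnS.
have ts_ i : (m < i)%N -> t i = s by move=> mi; rewrite /t nth_default// szl.
have ndt : nondecreasing_seq t.
  move=> i j ij; have [jm|mj] := leqP j m; first by apply: tlt; rewrite ij.
  rewrite (ts_ j)//; have [im|mi] := leqP i m; last by rewrite ts_.
  by have /la/andP[_ h] := tl _ im; rewrite (le_trans h)// ltW.
have lt_ r : r \in l -> exists2 i, (i <= m)%N & t i = r.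
  by move=> rl; exists (index r l); [rewrite -ltnS -szl index_mem|rewrite /t nth_index].
have t0 : t 0%N = 0.
  apply/eqP; rewrite eq_le; have /la/andP[-> _] := tl 0%N isT; rewrite andbT.
  have [i im <-] : exists2 i, (i <= m)%N & t i = 0 by apply: lt_; rewrite mem_sort inE eqxx.
  by apply: tlt; rewrite im.
have tm : t m = a.
  apply/eqP; rewrite eq_le; have /la/andP[_ ->] := tl m (leqnn _) => /=.
  have [i im <-] : exists2 i, (i <= m)%N & t i = a.
    by apply: lt_; rewrite mem_sort !inE eqxx orbT.
  by apply: tlt; rewrite im/=.
have tS : t m.+1 = s by rewrite ts_.
have := @independent_increment_rectangles m t; rewrite t0 tm tS => /(_ (lexx _) ndt).
apply: independent_systemsS => //; set C := increment_rectangles m t.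
have mX i : (i < m)%N -> measurable_fun setT
    ((W (t i.+1) \- W (t i)) : g_sigma_algebraType C -> R).
  move=> im; apply/measurable_g_sigmaP => _ [B mB <-]; rewrite setTI.
  apply: sub_sigma_algebra; exists (fun j => if j == i then B else setT).
    by move=> j; case: ifP.
  apply/seteqP; split => [w h j _ /=|w h].
    by case: eqP => [->|].
  by have := h i im; rewrite eqxx.
have mWt i : (i <= m)%N -> measurable_fun setT (W (t i) : g_sigma_algebraType C -> R).
  elim: i => [_|i IH im].
    rewrite t0 (_ : W 0 = cst 0); first exact: measurable_cst.
    by apply/funext => w; exact: (bm_start hW).
  rewrite (_ : W (t i.+1) = W (t i) \+ (W (t i.+1) \- W (t i))); last first.
    by apply/funext => w /=; rewrite addrC subrK.
  by apply: measurable_funD; [exact: (IH (ltnW im))|exact: mX].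
apply: sigma_process_sub => [|r /= rts]; first exact: smallest_sigma_algebra.
have [i im <-] : exists2 i, (i <= m)%N & t i = r.
  by apply: lt_; rewrite mem_sort !inE rts !orbT.
by apply/measurable_g_sigmaP; exact: mWt.
Qed.

Lemma independent_future_increment a s : 0 <= a -> a < s ->
  independent_systems P (sigma_process `[0, a] W)
    (g_sigma_algebra_preimage (W s \- W a)).
Proof.
move=> a0 as_; apply: independent_sigma_process.
- by move=> r /=; rewrite in_itv/= => /andP[r0 _]; exact: mW.
- apply: sub_preimage_measurable; apply: measurable_funB; apply: mW => //.
  by rewrite (le_trans a0)// ltW.
- by move=> ts tsa; apply: independent_future_increment_seq => // r /tsa.
Qed.

Lemma gaussian_increment a s : 0 <= a -> a < s -> gaussian_RV P (s - a) (W s \- W a).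
Proof.
move=> a0 as_ B mB; rewrite (bm_gaussian hW a0 as_ mB) normal_prob_gauss//.
by rewrite subr_gt0.
Qed.

Lemma gaussian_BM s : 0 < s -> gaussian_RV P s (W s).
Proof.
move=> s0; have := gaussian_increment (lexx 0) s0; rewrite subr0.
rewrite (_ : W s \- W 0 = W s)//; apply/funext => w /=.
by rewrite (bm_start hW) subr0.
Qed.

End brownian_increments.

(** * Brownian bridges through inverted increments *)

Section bridges.
Context {R : realType} {d} {T : measurableType d} (P : probability T R).
Variables (W : R -> T -> R) (hW : standard_brownian_motion P W).
Local Notation mu := (@lebesgue_measure R).

Let mW t : 0 <= t -> measurable_fun setT (W t).
Proof. exact: (bm_measurable hW). Qed.

(* [W r / r - W s / s] is an increment of the time-inverted motion
   [v |-> v W_{1/v}]. *)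
Definition inverted_increment s r w : R := W r w / r - W s w / s.

Definition bridge_algebra s := sigma_process `]0, s] (inverted_increment s).

Let mI s r : 0 <= s -> 0 <= r -> measurable_fun setT (inverted_increment s r).
Proof. by move=> s0 r0; apply: measurable_funB; apply: measurable_funM => //; exact: mW. Qed.

Lemma measurable_sigma_process (I : set R) (X : R -> T -> R) r : I r ->
  measurable_fun setT
    (X r : g_sigma_algebraType (\bigcup_(s in I) g_sigma_algebra_preimage (X s)) -> R).
Proof. by move=> Ir; apply/measurable_g_sigmaP; exact: (sub_sigma_process Ir). Qed.

Lemma inverted_increment_past s r : 0 < s -> 0 < r <= s ->
  measurable_fun setT (inverted_increment s r :
    g_sigma_algebraType (\bigcup_(q in `[0, s]) g_sigma_algebra_preimage (W q)) -> R).
Proof.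
move=> s0 /andP[r0 rs]; apply: measurable_funB; apply: measurable_funM => //.
  by apply: measurable_sigma_process; rewrite /= in_itv/= ltW.
by apply: measurable_sigma_process; rewrite /= in_itv/= ltW/=.
Qed.

Lemma independent_g_sigma_past (F : set (set T)) a s : 0 < a -> a < s ->
  F `<=` sigma_process `[0, a] W ->
  independent_systems P <<s F `|` g_sigma_algebra_preimage (W a) >>
    (g_sigma_algebra_preimage (W s \- W a)).
Proof.
move=> a0 as_ Fp.
apply: independent_systemsS (independent_future_increment hW (ltW a0) as_) => //.
apply: smallest_sub; first exact: smallest_sigma_algebra.
rewrite subUset; split => //; apply: sub_sigma_process.
by rewrite /= in_itv/= lexx ltW.
Qed.

Lemma independent_systems_trivial (G : set (set T)) : G `<=` measurable ->
  independent_systems P <<s [set setT] >> G.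
Proof.
move=> Gm; apply: independent_systems_g_sigma => //.
- by move=> A B -> ->; rewrite setIT.
- by move=> A ->.
- by move=> A B -> GB; rewrite setTI probability_setT mul1e.
Qed.

Lemma independent_cst (c : R) (G : set (set T)) : G `<=` measurable ->
  independent_systems P G (g_sigma_algebra_preimage (cst c : T -> R)).
Proof.
move=> Gm; apply: independent_systemsC.
apply: independent_systemsS (independent_systems_trivial Gm) => //.
by apply/measurable_g_sigmaP; exact: measurable_cst.
Qed.

Section residual.
Variables (F : set (set T)) (a s : R).
Hypotheses (a0 : 0 < a) (as_ : a < s).
Hypotheses (Fp : F `<=` sigma_process `[0, a] W)
  (Fa : independent_systems P <<s F >> (g_sigma_algebra_preimage (W a))).
Let xi w : R := W a w - a / s * W s w.

Let s0 : 0 < s. Proof. exact: lt_trans as_. Qed.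

Let Fm : F `<=` measurable.
Proof.
apply: subset_trans Fp _; apply: sigma_process_measurable => r /=.
by rewrite in_itv/= => /andP[r0 _]; exact: mW.
Qed.

Let mxi : measurable_fun setT xi.
Proof.
by apply: measurable_funB; [exact/mW/ltW|apply: measurable_funM => //; exact/mW/ltW].
Qed.

(** Regression of [W a] on [W s], where [W s] is the sum of [W a] and the independent increment
    after [a]. *)
Let regression E C1 C2 : <<s F >> E -> measurable C1 -> measurable C2 ->
  (P (E `&` xi @^-1` C1 `&` W s @^-1` C2) =
   P E * \int[mu]_(x in C1) (gauss (a * (s - a) / s) x)%:E
       * \int[mu]_(x in C2) (gauss s x)%:E)%E.
Proof.
move=> FE mC1 mC2.
have := gaussian_regression a0 _ Fm (mW (ltW a0)) _ (gaussian_BM hW a0)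
  (gaussian_increment hW (ltW a0) as_) Fa (independent_g_sigma_past a0 as_ Fp) FE mC1 mC2.
rewrite subr_gt0 => /(_ as_).
have -> : (fun w => W a w + (W s \- W a) w) = W s.
  by apply/funext => w /=; rewrite addrC subrK.
rewrite (_ : a + (s - a) = s); last by rewrite addrC subrK.
rewrite (_ : (fun w => _) = xi); last first.
  by apply/funext => w; rewrite /xi; congr (_ - _ * _); rewrite /= addrC subrK.
by apply; apply: measurable_funB; apply: mW; exact: ltW.
Qed.

Let v0 : 0 < a * (s - a) / s.
Proof. by rewrite divr_gt0// mulr_gt0// subr_gt0. Qed.

Let int1 c : 0 < c -> (\int[mu]_(x in setT) (gauss c x)%:E = 1)%E.
Proof.
by move=> c0; rewrite -[RHS](integral_gauss 0 c0); under [RHS]eq_integral do rewrite addr0.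
Qed.

Lemma residual_gaussian : gaussian_RV P (a * (s - a) / s) xi.
Proof.
move=> B mB.
have := regression (@sub_sigma_setT _ T F) mB measurableT.
by rewrite setTI preimage_setT setIT probability_setT mul1e int1// mule1.
Qed.

Lemma residual_independent :
  independent_systems P <<s F >> (g_sigma_algebra_preimage xi).
Proof.
move=> A _ FA [C mC <-]; rewrite setTI (residual_gaussian mC).
have := regression FA mC measurableT.
by rewrite preimage_setT setIT int1// mule1.
Qed.

(** The triple product formula of [regression] is exactly what joining [F] with the residual
    requires. *)
Lemma residual_endpoint_independent :
  independent_systems P <<s <<s F >> `|` g_sigma_algebra_preimage xi >>
    (g_sigma_algebra_preimage (W s)).
Proof.
apply: independent_systems_join.
- exact: smallest_sigma_algebra.
- exact: sigma_algebra_preimage_RV.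
- exact: sub_g_sigma_measurable.
- exact: sub_preimage_measurable.
- exact/sub_preimage_measurable/mW/ltW.
- move=> A _ _ FA [C1 mC1 <-] [C2 mC2 <-]; rewrite !setTI regression//.
  congr (_ * _)%E; last by rewrite (gaussian_BM hW s0 mC2).
  have := regression FA mC1 measurableT.
  by rewrite preimage_setT setIT int1// mule1 => <-.
Qed.

End residual.

(* Lowering the terminal time from [s] to [a]: the increments before [a] and
   the residual of [W a] on [W s] are jointly independent of [W s]. *)
Lemma bridge_seq_independent (ts : seq R) s : 0 < s -> sorted <=%R ts ->
  (forall r, r \in ts -> 0 < r <= s) ->
  independent_systems P (sigma_process [set` ts] (inverted_increment s))
    (g_sigma_algebra_preimage (W s)).
Proof.
elim/last_ind: ts s => [|ts a IH] s s0 sts tss.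
  have mWs := sub_preimage_measurable (mW (ltW s0)).
  apply: independent_systemsS (independent_systems_trivial mWs) => //.
  by apply: sigma_process_sub => [|r]; first exact: smallest_sigma_algebra.
have /andP[a0 as_] : 0 < a <= s by apply: tss; rewrite mem_rcons inE eqxx.
have sts' : sorted <=%R ts.
  by apply: subseq_sorted sts; [exact: le_trans|exact: subseq_rcons].
have tsa r : r \in ts -> 0 < r <= a.
  move=> rts; have /andP[-> _] : 0 < r <= s by apply: tss; rewrite mem_rcons inE rts orbT.
  rewrite /=; move: sts; rewrite -cats1 sorted_pairwise ?pairwise_cat; last exact: le_trans.
  by move=> /andP[/allrelP/(_ r a rts)]; rewrite inE eqxx => ->.
(* If the last time is [s] itself, its inverted increment is 0 and contributes nothing. *)
move: as_; rewrite le_eqVlt => /orP[/eqP as_|as_].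
  apply: independent_systemsS (IH s s0 sts' _) => //; last by rewrite -as_.
  apply: sigma_process_sub => [|r /=]; first exact: smallest_sigma_algebra.
  rewrite mem_rcons inE => /orP[/eqP ->|rts]; last exact: sub_sigma_process.
  apply/measurable_g_sigmaP; rewrite as_ (_ : inverted_increment s s = cst 0).
    exact: measurable_cst.
  by apply/funext => w; rewrite /inverted_increment subrr.
pose F := \bigcup_(r in [set` ts]) g_sigma_algebra_preimage (inverted_increment a r).
have Fp : F `<=` sigma_process `[0, a] W.
  move=> A [r /= rts]; move: A.
  exact: (proj1 (measurable_g_sigmaP _ _) (inverted_increment_past a0 (tsa _ rts))).
have := residual_endpoint_independent a0 as_ Fp (IH a a0 sts' tsa).
apply: independent_systemsS => //.
set G := _ `|` _.
have mxi : measurable_fun setT ((fun w => W a w - a / s * W s w) : g_sigma_algebraType G -> R).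
  by apply/measurable_g_sigmaP => A HA; apply: sub_sigma_algebra; right.
apply: sigma_process_sub => [|r /=]; first exact: smallest_sigma_algebra.
rewrite mem_rcons inE => /orP[/eqP ->|rts]; apply/measurable_g_sigmaP.
  rewrite (_ : inverted_increment s a = fun w => (W a w - a / s * W s w) / a).
    exact: measurable_funM.
  by apply/funext => w; rewrite /inverted_increment; field; rewrite !gt_eqF.
(* The change of reference time from [a] to [s] adds the same multiple of the residual to every
   inverted increment. *)
rewrite (_ : inverted_increment s r = fun w => inverted_increment a r w +
    (W a w - a / s * W s w) / a); last first.
  have /andP[r0 _] := tsa _ rts.
  by apply/funext => w; rewrite /inverted_increment; field; rewrite !gt_eqF.
apply: measurable_funD; last exact: measurable_funM.
apply/measurable_g_sigmaP => A HA; apply: sub_sigma_algebra; left.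
exact: sub_sigma_process HA.
Qed.

Lemma bridge_independent s : 0 < s ->
  independent_systems P (bridge_algebra s) (g_sigma_algebra_preimage (W s)).
Proof.
move=> s0; apply: independent_sigma_process.
- by move=> r; rewrite /= in_itv/= => /andP[r0 _]; apply: mI; exact: ltW.
- exact/sub_preimage_measurable/mW/ltW.
- move=> ts tss; have := @bridge_seq_independent (sort <=%R ts) s s0 (sort_le_sorted _).
  rewrite (_ : [set` sort <=%R ts] = [set` ts]); last first.
    by apply/seteqP; split => r /=; rewrite mem_sort.
  by apply => r; rewrite mem_sort => /tss; rewrite /= in_itv.
Qed.

Lemma bridge_algebra_past s : 0 < s ->
  (\bigcup_(r in `]0, s]) g_sigma_algebra_preimage (inverted_increment s r))
    `<=` sigma_process `[0, s] W.
Proof.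
move=> s0 A [r]; rewrite /= in_itv/= => /(inverted_increment_past s0)/measurable_g_sigmaP.
exact.
Qed.

Lemma bridge_residual_gaussian s r : 0 < s -> s < r ->
  gaussian_RV P (s * (r - s) / r) (fun w => W s w - s / r * W r w).
Proof.
move=> s0 sr.
exact: (residual_gaussian s0 sr (bridge_algebra_past s0) (bridge_independent s0)).
Qed.

Lemma bridge_residual_independent s r : 0 < s -> s < r ->
  independent_systems P (bridge_algebra s)
    (g_sigma_algebra_preimage (fun w => W s w - s / r * W r w)).
Proof.
move=> s0 sr.
exact: (residual_independent s0 sr (bridge_algebra_past s0) (bridge_independent s0)).
Qed.

Lemma measurable_inverted_incrementS s u r : 0 < s -> s <= u -> 0 < r <= s ->
  measurable_fun setT (inverted_increment s r :
    g_sigma_algebraType (\bigcup_(q in `]0, u]) g_sigma_algebra_preimage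
      (inverted_increment u q)) -> R).
Proof.
move=> s0 su /andP[r0 rs].
rewrite (_ : inverted_increment s r = inverted_increment u r \- inverted_increment u s).
  apply: measurable_funB; apply: measurable_sigma_process; rewrite /= in_itv/= ?r0 ?s0//.
  exact: le_trans su.
by apply/funext => w; rewrite /inverted_increment /=; ring.
Qed.

Lemma bridge_algebraS s u : 0 < s -> s <= u -> bridge_algebra s `<=` bridge_algebra u.
Proof.
move=> s0 su; apply: sigma_process_sub => [|r]; first exact: smallest_sigma_algebra.
rewrite /= in_itv/= => rs.
by apply/measurable_g_sigmaP; exact: measurable_inverted_incrementS.
Qed.

(** The residual is a multiple of an inverted increment. A bridge on [[0, s]] together with its
    residual relative to [u] is thus part of the bridge algebra at [u], hence independent of later
    residuals. *)
Lemma residual_sub_bridge_algebra s u : 0 < s -> s <= u ->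
  g_sigma_algebra_preimage (fun w => W s w - s / u * W u w) `<=` bridge_algebra u.
Proof.
move=> s0 su; apply/measurable_g_sigmaP.
rewrite (_ : (fun w => _) = fun w => s * inverted_increment u s w).
  by apply: measurable_funM => //; apply: measurable_sigma_process; rewrite /= in_itv/= s0.
apply/funext => w; rewrite /inverted_increment; field.
by rewrite !gt_eqF// (lt_le_trans s0).
Qed.

End bridges.

Lemma measurable_invr {R : realType} : measurable_fun setT (@GRing.inv R).
Proof.
(* Squaring gives the real power a nonnegative base; the formula is also right at 0, where both
   sides are 0. *)
rewrite (_ : GRing.inv = fun x : R => x * ((x ^+ 2) `^ (-1))).
  apply: measurable_funM => //; apply: (measurableT_comp (measurable_powR (-1))).
  exact: measurable_funX.
apply/funext => x; rewrite powRN powRr1 ?sqr_ge0// expr2 invfM mulrA.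
by have [->|x0] := eqVneq x 0; [rewrite invr0 !mulr0|rewrite divff// mul1r].
Qed.

Lemma cvg_maxr_cst {R : realType} (u : nat -> R) (l s : R) :
  u n @[n --> \oo] --> l -> Num.max (u n) s @[n --> \oo] --> Num.max l s.
Proof.
move=> ul; rewrite maxr_absE; under eq_fun do rewrite maxr_absE.
apply: cvgMl; apply: cvgD; first by apply: cvgD => //; exact: cvg_cst.
by apply: cvg_norm; apply: cvgB => //; exact: cvg_cst.
Qed.

(** * Joint measurability in the time and the path *)

Section joint_measurability.
Context {R : realType} {d} {T : measurableType d} (P : probability T R).
Variables (W : R -> T -> R) (hW : standard_brownian_motion P W).

Lemma BM_cvg (u : nat -> R) (l : R) (w : T) : (forall n, 0 <= u n) -> 0 <= l ->
  u n @[n --> \oo] --> l -> W (u n) w @[n --> \oo] --> W l w.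
Proof.
move=> u0 l0 ul; have cont : {within `[0, +oo[, continuous (W ^~ w)} by exact: (bm_continuous hW).
have cW : W x w @[x --> within `[0, +oo[ (nbhs l)] --> W l w.
  by move/subspace_continuousP : cont; apply; rewrite /= in_itv/= l0.
apply: cvg_trans cW => A; rewrite /nbhs/= /within/= => hA.
have : \forall n \near \oo, u n \in `[0, +oo[ -> A (W (u n) w) by exact: ul hA.
by apply: filterS => n; apply; rewrite in_itv/= u0.
Qed.

Definition BM_generators : set (set T) :=
  \bigcup_(q in `[0, +oo[) g_sigma_algebra_preimage (W q).

Lemma BM_generators_measurable : BM_generators `<=` measurable.
Proof.
move=> A [r]; rewrite /= in_itv/= andbT => r0; move: A.
by apply: sub_preimage_measurable; exact: (bm_measurable hW).
Qed.

(** Rounding the time down to a grid of mesh [1 / n.+1] gives countably many rectangles, and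
    continuity of paths gives the limit. The second factor carries only the sigma-algebra of the
    path, so that independence of [tau] and [W] can be applied to functions of both. *)
Lemma measurable_BM_eval s : 0 <= s ->
  measurable_fun setT
    (fun z : R * g_sigma_algebraType BM_generators => W (Num.max z.1 s) z.2).
Proof.
move=> s0.
pose q n (r : R) : R := (Num.floor (r * n.+1%:R))%:~R / n.+1%:R.
have n0 n : (0 : R) < n.+1%:R by rewrite ltr0n.
have qr r : q n r @[n --> \oo] --> r.
  apply/cvgrPdist_lt => e e0; near=> n.
  have /andP[fl fu] := floor_itv (r * n.+1%:R).
  have ne : n.+1%:R^-1 < e by near: n; exact: (near_infty_natSinv_lt (PosNum e0)).
  rewrite ger0_norm; last by rewrite subr_ge0 ler_pdivrMr.
  apply: lt_trans ne; rewrite ltrBlDl -ltrBlDr.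
  rewrite ltr_pdivlMr// mulrBl mulVf ?gt_eqF// ltrBlDr.
  by rewrite -[1]/(1%:~R) -intrD.
pose h n (z : R * g_sigma_algebraType BM_generators) := W (Num.max (q n z.1) s) z.2.
have mh n : measurable_fun setT (h n).
  move=> _ B mB; rewrite setTI.
  (* On the [k]-th cell the rounded time is constant, which makes each piece a rectangle. *)
  pose E (k : int) := [set z : R * g_sigma_algebraType BM_generators |
    `[k%:~R / n.+1%:R, (k + 1)%:~R / n.+1%:R[%classic z.1 /\
    B (W (Num.max (k%:~R / n.+1%:R) s) z.2)].
  rewrite (_ : _ @^-1` B = \bigcup_(k : int) E k); last first.
    apply/seteqP; split => [[r w] /= hB|[r w] [k _] [/=]].
      exists (Num.floor (r * n.+1%:R)) => //; split => //=.
      by rewrite in_itv/= ler_pdivrMr// ltr_pdivlMr// floor_itv.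
    rewrite in_itv/= ler_pdivrMr// ltr_pdivlMr// => /floor_def fk.
    by rewrite /h /q /= fk.
  apply: countable_bigcupT_measurable; first exact: countableP.
  move=> k; rewrite (_ : E k = `[k%:~R / n.+1%:R, (k + 1)%:~R / n.+1%:R[%classic `*`
     (W (Num.max (k%:~R / n.+1%:R) s) @^-1` B)); last first.
    by apply/seteqP; split => -[r w].
  apply: measurableX; first exact: measurable_itv.
  apply: sub_sigma_algebra; exists (Num.max (k%:~R / n.+1%:R) s).
    by rewrite /= in_itv/= andbT le_max s0 orbT.
  by exists B => //; rewrite setTI.
apply: (measurable_fun_cvg mh) => -[r w] _; rewrite /h /=; apply: BM_cvg.
  + by move=> n; rewrite le_max s0 orbT.
  + by rewrite le_max s0 orbT.
  + exact: cvg_maxr_cst.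
Unshelve. all: by end_near. Qed.

(** The bridge length becomes a variable: at the pair [(tau w, w)] this is the information process,
    and independence allows [tau] to be frozen. *)
Definition fixed_information t (z : R * T) := information_process W (fun=> z.1) t z.2.

Lemma measurable_fixed_information t : 0 <= t ->
  measurable_fun setT (fixed_information t : R * g_sigma_algebraType BM_generators -> R).
Proof.
move=> t0.
have mWt : measurable_fun setT (W t : g_sigma_algebraType BM_generators -> R).
  by apply: measurable_sigma_process; rewrite /= in_itv/= t0.
have mm : measurable_fun setT (fun z : R * g_sigma_algebraType BM_generators => Num.max z.1 t).
  by apply: measurable_maxr => //; exact: measurable_fst.
apply: measurable_funB.
  exact: (measurableT_comp mWt measurable_snd).
apply: measurable_funM; last exact: measurable_BM_eval.
apply: measurable_funM => //.
exact: (measurableT_comp measurable_invr mm).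
Qed.

Lemma measurable_information (tau : T -> R) t : 0 <= t ->
  measurable_fun setT tau -> measurable_fun setT (information_process W tau t).
Proof.
move=> t0 mtau.
have := measurableT_comp (measurable_fixed_information t0)
  (measurable_fun_pair mtau (measurable_id_g_sigma BM_generators_measurable)).
exact.
Qed.

End joint_measurability.

Section independent_gaussian_pair.
Context {R : realType} {d} {T : measurableType d} (P : probability T R).
Local Notation mu := (@lebesgue_measure R).
Local Open Scope ereal_scope.

(** The nested hypotheses make [D], [X] and [V] mutually independent. [V] is integrated out first,
    then [X]; Tonelli's theorem restores the order in which [V] is outermost. *)
Lemma independent_gaussian_pair_integral (F : set (set T)) a (X V : T -> R)
    (f : R * R -> \bar R) D :
  F `<=` measurable -> measurable_fun setT X -> measurable_fun setT V ->
  gaussian_RV P a X ->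
  independent_systems P <<s F >> (g_sigma_algebra_preimage X) ->
  independent_systems P <<s F `|` g_sigma_algebra_preimage X >>
    (g_sigma_algebra_preimage V) ->
  measurable_fun setT f -> (forall z, 0 <= f z) -> <<s F >> D ->
  \int[P]_w ((\1_D w)%:E * f (V w, X w)) =
  P D * \int[P]_w \int[mu]_x (f (V w, x) * (gauss a x)%:E).
Proof.
move=> Fm mX mV lX FX FXV mf f0 FD.
have mD := sub_g_sigma_measurable Fm FD.
set F' := F `|` g_sigma_algebra_preimage X.
have F'm : F' `<=` measurable.
  by rewrite subUset; split => //; exact: sub_preimage_measurable.
have mX' : measurable_fun setT (X : g_sigma_algebraType F' -> R).
  by apply/measurable_g_sigmaP => A XA; apply: sub_sigma_algebra; right.
have mD' : measurable (D : set (g_sigma_algebraType F')).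
  by apply: sub_smallest2r FD; [exact: smallest_sigma_algebra|move=> A; left].
pose h1 (z : g_sigma_algebraType F' * R) := (\1_D z.1)%:E * f (z.2, X z.1).
have mh1 : measurable_fun setT h1.
  apply: emeasurable_funM.
    apply/measurable_EFinP.
    exact: (measurableT_comp (measurable_indic mD') measurable_fst).
  exact: (measurableT_comp mf
    (measurable_fun_pair measurable_snd (measurableT_comp mX' measurable_fst))).
have h10 z : 0 <= h1 z by rewrite mule_ge0// lee_fin.
have idF' : independent_systems P
    (g_sigma_algebra_preimage (id : T -> g_sigma_algebraType F'))
    (g_sigma_algebra_preimage V).
  by move=> A B [A' FA' <-]; rewrite setTI; exact: FXV.
have step1 := independent_integral (measurable_id_g_sigma F'm) mV idF' mh1 h10.
rewrite [LHS]step1 {step1}.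
pose k x := \int[P]_w f (V w, x).
have mk : measurable_fun setT k.
  apply: (measurable_fun_fubini_tonelli_G (m1 := P) (fun z : T * R => f (V z.1, z.2))) => //.
  exact: (measurableT_comp mf
    (measurable_fun_pair (measurableT_comp mV measurable_fst) measurable_snd)).
have k0 x : 0 <= k x by exact: integral_ge0.
have mfV x : measurable_fun setT (fun w => f (V w, x)).
  exact: (measurableT_comp mf (measurable_fun_pair mV (measurable_cst x))).
pose h2 (z : g_sigma_algebraType F * R) := (\1_D z.1)%:E * k z.2.
have mh2 : measurable_fun setT h2.
  apply: emeasurable_funM.
    apply/measurable_EFinP.
    exact: (measurableT_comp (measurable_indic (FD : measurable (D : set (g_sigma_algebraType F)))) measurable_fst).
  exact: (measurableT_comp mk measurable_snd).
have h20 z : 0 <= h2 z by rewrite mule_ge0// lee_fin.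
transitivity (\int[P]_w h2 (w, X w)).
  apply: eq_integral => w _; rewrite /h1 /h2/=.
  by apply: ge0_integralZl => //; exact: mfV.
have step2 := independent_gaussian_integral Fm mX lX FX mh2 h20.
rewrite [LHS]step2 {step2}.
pose J := \int[mu]_x (k x * (gauss a x)%:E).
have mkg : measurable_fun setT (fun x => k x * (gauss a x)%:E).
  by apply: emeasurable_funM => //; apply/measurable_EFinP; exact: measurable_gauss.
have kg0 x : 0 <= k x * (gauss a x)%:E by rewrite mule_ge0 ?lee_fin ?gauss_ge0.
have J0 : 0 <= J by apply: integral_ge0 => x _; exact: kg0.
transitivity (\int[P]_w ((\1_D w)%:E * J)).
  apply: eq_integral => w _; rewrite /h2.
  apply: etrans; last apply: ge0_integralZl.
  - by apply: eq_integral => y _; rewrite muleA.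
  - exact: measurableT.
  - exact: mkg.
  - by move=> x _; exact: kg0.
  - by [].
rewrite ge0_integralZr//; last by apply/measurable_EFinP; exact: measurable_indic.
rewrite integral_indic// setIT; congr (_ * _).
pose q (z : T * R) := f (V z.1, z.2) * (gauss a z.2)%:E.
have mq : measurable_fun setT q.
  apply: emeasurable_funM.
    exact: (measurableT_comp mf
      (measurable_fun_pair (measurableT_comp mV measurable_fst) measurable_snd)).
  by apply/measurable_EFinP; apply: measurable_gauss => //; exact: measurable_snd.
have q0 z : 0 <= q z by rewrite mule_ge0 ?lee_fin ?gauss_ge0.
have := fubini_tonelli (m1 := P) (m2 := mu) q mq q0; rewrite /q/= => ->.
apply: eq_integral => x _; apply/esym; apply: ge0_integralZr => //.
by rewrite lee_fin gauss_ge0.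
Qed.

End independent_gaussian_pair.

(** * The density of the information process at an earlier time *)

Section bridge_kernel.
Context {R : realType} {d} {T : measurableType d} (P : probability T R).
Variables (W : R -> T -> R) (hW : standard_brownian_motion P W).
Variables (tau : T -> R) (mtau : measurable_fun setT tau) (tau0 : forall w, 0 < tau w).
Hypothesis hind : independent_systems P (g_sigma_algebra_preimage tau)
  (sigma_process `[0, +oo[ W).
Local Notation mu := (@lebesgue_measure R).
Local Notation beta := (information_process W tau).
Local Open Scope ereal_scope.

(* On [s < tau], [beta s - s / u * beta u] is the value at time [s] of a Brownian
   bridge of length [min u tau]; this is its variance. *)
Definition bridge_variance (s u r : R) : R := (s * (Num.min u r - s) / Num.min u r)%R.

(* The conditional law of [beta s] on [s < tau], weighted by [g (beta u)]. *)
Definition bridge_density (g : R -> R) (s u x : R) : \bar R :=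
  \int[P]_w (g (beta u w) * gauss (bridge_variance s u (tau w)) (x - s / u * beta u w))%:E.

Lemma bridge_variance_gt0 s u r : (0 < s -> s < u -> s < r -> 0 < bridge_variance s u r)%R.
Proof.
move=> s0 su sr; have ? : (s < Num.min u r)%R by rewrite lt_min su.
by rewrite divr_gt0 ?mulr_gt0 ?subr_gt0// (lt_trans s0).
Qed.

(** Combined with [gauss_le0], this makes [bridge_density] ignore the paths already absorbed at time
    [s]. *)
Lemma bridge_variance_le0 s u r : (0 < s -> s < u -> 0 < r -> r <= s ->
  bridge_variance s u r <= 0)%R.
Proof.
move=> s0 su r0 rs; have ru : (r <= u)%R by rewrite (le_trans rs)// ltW.
rewrite /bridge_variance (min_r ru) mulr_le0_ge0//; last by rewrite invr_ge0 ltW.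
by rewrite mulr_ge0_le0 ?subr_le0// ltW.
Qed.

Lemma measurable_bridge_variance s u :
  measurable_fun setT (fun r => bridge_variance s u r).
Proof.
have mm : measurable_fun setT (fun r : R => Num.min u r) by exact: measurable_minr.
apply: measurable_funM; last exact: (measurableT_comp measurable_invr mm).
by apply: measurable_funM => //; exact: measurable_funB.
Qed.

(** If [u <= r], the bridge of length [r] at time [s] is a bridge of length [u] plus linear
    interpolation of its value at [u]. If [r < u], that value is 0 and the bridge has length [r]. *)
Lemma information_process_fixed s u (r : R) w : (0 < s)%R -> (s < u)%R -> (s < r)%R ->
  fixed_information W s (r, w) =
  (W s w - s / Num.min u r * W (Num.min u r) w + s / u * fixed_information W u (r, w))%R.
Proof.
move=> s0 su sr; have u0 := lt_trans s0 su; have r0 := lt_trans s0 sr.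
rewrite /fixed_information /information_process /= (max_l (ltW sr)).
have [ur|ru] := leP u r.
  by field; rewrite !gt_eqF.
by field; rewrite !gt_eqF.
Qed.

(** For a frozen length [r], the bridge algebra, the residual [xi] and the value [V] at [u] are
    mutually independent. Given [V], the value at [s] is therefore Gaussian with mean [s / u * V],
    independently of [D]. *)
Lemma fixed_information_integral s u r D (g psi : R -> R) :
  (0 < s)%R -> (s < u)%R -> (s < r)%R -> bridge_algebra W s D ->
  measurable_fun setT g -> measurable_fun setT psi ->
  (forall x, 0 <= g x)%R -> (forall x, 0 <= psi x)%R ->
  \int[P]_w ((\1_D w)%:E * (g (fixed_information W u (r, w)) *
     psi (fixed_information W s (r, w)))%:E) =
  P D * \int[P]_w \int[mu]_x (psi x * (g (fixed_information W u (r, w)) *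
     gauss (bridge_variance s u r) (x - s / u * fixed_information W u (r, w))%R))%:E.
Proof.
move=> s0 su sr HD mg mpsi g0 psi0.
have u0 := lt_trans s0 su; have r0 := lt_trans s0 sr.
pose rho := Num.min u r; have srho : (s < rho)%R by rewrite lt_min su.
have rho0 := lt_trans s0 srho.
pose xi w := (W s w - s / rho * W rho w)%R.
pose V w := fixed_information W u (r, w).
have mW q : (0 <= q)%R -> measurable_fun setT (W q) by exact: (bm_measurable hW).
have mV : measurable_fun setT V.
  apply: measurable_funB; first exact/mW/ltW.
  by apply: measurable_funM => //=; apply: mW; rewrite le_max (ltW u0) orbT.
have mxi : measurable_fun setT xi.
  by apply: measurable_funB; [|apply: measurable_funM => //]; exact/mW/ltW.
pose F := \bigcup_(q in `]0%R, s]) g_sigma_algebra_preimage (inverted_increment W s q).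
have Fm : F `<=` measurable.
  apply: subset_trans (bridge_algebra_past (W := W) s0) _.
  by apply: sigma_process_measurable => q /=; rewrite in_itv/= => /andP[? _]; exact: mW.
have lxi : gaussian_RV P (bridge_variance s u r) xi := bridge_residual_gaussian hW s0 srho.
have Fxi := bridge_residual_independent hW s0 srho.
have FV : independent_systems P <<s F `|` g_sigma_algebra_preimage xi >>
    (g_sigma_algebra_preimage V).
  (* If [u < r], then [V] is itself a residual, independent of the bridge algebra at [u], which
     contains both [F] and [xi]. Otherwise [V] is the constant 0. *)
  have [ur|ru] := ltP u r.
    have rhoE : rho = u by rewrite /rho min_l// ltW.
    have VE : V = (fun w => W u w - u / r * W r w)%R.
      by apply/funext => w; rewrite /V /fixed_information /information_process/= max_l// ltW.
    rewrite VE; apply: independent_systemsS (bridge_residual_independent hW u0 ur) => //.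
    apply: smallest_sub; first exact: smallest_sigma_algebra.
    rewrite subUset; split.
      by move=> A FA; apply: (bridge_algebraS s0 (ltW su)); exact: sub_sigma_algebra.
    by rewrite /xi rhoE; apply: residual_sub_bridge_algebra => //; exact: ltW.
  have -> : V = cst 0%R.
    apply/funext => w; rewrite /V /fixed_information /information_process/= max_r//.
    by rewrite divff ?gt_eqF// mul1r subrr.
  apply: independent_cst; apply: sub_g_sigma_measurable.
  by rewrite subUset; split => //; exact: sub_preimage_measurable.
pose f (z : R * R) := (g z.1 * psi (z.2 + s / u * z.1))%:E.
have mf : measurable_fun setT f.
  apply/measurable_EFinP; apply: measurable_funM; first exact: (measurableT_comp mg measurable_fst).
  apply: (measurableT_comp mpsi); apply: measurable_funD; first exact: measurable_snd.
  by apply: measurable_funM => //; exact: measurable_fst.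
have f0 z : 0 <= f z by rewrite lee_fin mulr_ge0.
have pairE := independent_gaussian_pair_integral Fm mxi mV lxi Fxi FV mf f0 HD.
transitivity (\int[P]_w ((\1_D w)%:E * f (V w, xi w))).
  by apply: eq_integral => w _; rewrite (information_process_fixed w s0 su sr).
rewrite pairE; congr (_ * _); apply: eq_integral => w _.
have mh : measurable_fun setT (fun x : R => (psi x * (g (V w) *
   gauss (bridge_variance s u r) (x - s / u * V w)%R))%:E).
  apply/measurable_EFinP; apply: measurable_funM => //; apply: measurable_funM => //.
  by apply: measurable_gauss => //; exact: measurable_funB.
have h0 x : 0 <= (psi x * (g (V w) *
   gauss (bridge_variance s u r) (x - s / u * V w)%R))%:E.
  by rewrite lee_fin !mulr_ge0 ?gauss_ge0.
apply: etrans (ge0_integral_shift (s / u * V w)%R mh h0).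
apply: eq_integral => x _; rewrite /f/= -EFinM addrK; congr EFin.
by rewrite -!mulrA mulrCA.
Qed.

Lemma measurable_density_integrand (g psi : R -> R) s u :
  (0 < u)%R -> measurable_fun setT g -> measurable_fun setT psi ->
  measurable_fun setT (fun z : (R * g_sigma_algebraType (BM_generators W)) * R =>
    (psi z.2 * (g (fixed_information W u z.1) * gauss (bridge_variance s u z.1.1)
        (z.2 - s / u * fixed_information W u z.1)))%:E).
Proof.
move=> u0 mg mpsi; have mfi := measurable_fixed_information hW (ltW u0).
apply/measurable_EFinP; apply: measurable_funM.
  exact: (measurableT_comp mpsi measurable_snd).
have mfi1 := measurableT_comp mfi (@measurable_fst _ _ (R * g_sigma_algebraType (BM_generators W))%type R).
apply: measurable_funM; first exact: (measurableT_comp mg mfi1).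
apply: measurable_gauss.
  apply: (measurableT_comp (measurable_bridge_variance s u)).
  exact: (measurableT_comp measurable_fst measurable_fst).
by apply: measurable_funB; [exact: measurable_snd|exact: measurable_funM].
Qed.

(** The factor [P D] expresses that, on [s < tau], the bridge algebra says nothing about the pair
    formed by [beta s] and [beta u]. With [g = 1] the same identity gives the law of [beta s], so
    comparing the two produces the kernel. *)
Lemma information_density_integral s u D (g psi : R -> R) :
  (0 < s)%R -> (s < u)%R -> bridge_algebra W s D ->
  measurable_fun setT g -> measurable_fun setT psi ->
  (forall x, 0 <= g x)%R -> (forall x, 0 <= psi x)%R ->
  \int[P]_w ((\1_D w)%:E * ((s < tau w)%R%:R * (g (beta u w) * psi (beta s w)))%:E) =
  P D * \int[mu]_x ((psi x)%:E * bridge_density g s u x).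
Proof.
move=> s0 su HD mg mpsi g0 psi0; have u0 := lt_trans s0 su.
pose TW := g_sigma_algebraType (BM_generators W).
have mfu : measurable_fun setT (fixed_information W u : R * TW -> R).
  exact: (measurable_fixed_information hW (ltW u0)).
have mfs : measurable_fun setT (fixed_information W s : R * TW -> R).
  exact: (measurable_fixed_information hW (ltW s0)).
have mD' : measurable (D : set TW).
  have : sigma_process `[0%R, s] W D.
    apply: (smallest_sub (smallest_sigma_algebra _ _) (bridge_algebra_past s0)) HD.
  by apply: sigma_processS => q /=; rewrite !in_itv/= andbT => /andP[].
have mid := measurable_id_g_sigma (BM_generators_measurable hW).
have mD : measurable D by rewrite -[D]setTI; exact: (mid measurableT D mD').
pose h (z : R * TW) := (\1_D z.2)%:E * ((s < z.1)%R%:R *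
  (g (fixed_information W u z) * psi (fixed_information W s z)))%:E.
have mh : measurable_fun setT h.
  apply: emeasurable_funM; apply/measurable_EFinP.
    exact: (measurableT_comp (measurable_indic mD') measurable_snd).
  apply: measurable_funM.
    have ms : measurable_fun setT (fun r : R => (s < r)%R%:R : R).
      rewrite (_ : (fun r => _) = \1_(`]s, +oo[%classic : set R)).
        exact: measurable_indic.
      by apply/funext => r; rewrite indicE/= mem_setE in_itv/= andbT.
    exact: (measurableT_comp ms measurable_fst).
  by apply: measurable_funM; [exact: (measurableT_comp mg)|exact: (measurableT_comp mpsi)].
have h0 z : 0 <= h z by rewrite mule_ge0 ?lee_fin// !mulr_ge0.
have indep : independent_systems P (g_sigma_algebra_preimage tau)
    (g_sigma_algebra_preimage (id : T -> TW)).
  by move=> A _ HA [B HB <-]; rewrite setTI; exact: hind.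
have := independent_integral mtau mid indep mh h0; rewrite {1}/h/= => ->.
pose k (z : (R * TW) * R) := (psi z.2 * (g (fixed_information W u z.1) *
  gauss (bridge_variance s u z.1.1) (z.2 - s / u * fixed_information W u z.1)))%:E.
have mk : measurable_fun setT k by exact: measurable_density_integrand.
have k0 z : 0 <= k z by rewrite lee_fin !mulr_ge0 ?gauss_ge0.
pose Theta (z : R * TW) := \int[mu]_x k (z, x).
have mTheta : measurable_fun setT Theta.
  exact: (measurable_fun_fubini_tonelli_F (m2 := mu) k mk k0).
have Theta0 z : 0 <= Theta z by apply: integral_ge0 => x _; exact: k0.
have mThetar r : measurable_fun setT (fun w : T => Theta (r, w)).
  exact: (measurableT_comp mTheta (measurable_fun_pair (measurable_cst r) mid)).
have mTT : measurable_fun setT (fun z : T * T => Theta (tau z.1, z.2)).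
  exact: (measurableT_comp mTheta (measurable_fun_pair
    (measurableT_comp mtau measurable_fst) (measurableT_comp mid measurable_snd))).
have mI : measurable_fun setT (fun w => \int[P]_w' Theta (tau w, w')).
  exact: (measurable_fun_fubini_tonelli_F (m2 := P) _ mTT (fun z => Theta0 _)).
transitivity (\int[P]_w (P D * \int[P]_w' Theta (tau w, w'))).
  (* For [tau w <= s] both sides vanish: the left by its indicator, the right because the variance
     is nonpositive. *)
  apply: eq_integral => w _; have [st|ts] := ltP s (tau w).
    apply: etrans (fixed_information_integral s0 su st HD mg mpsi g0 psi0).
    by apply: eq_integral => w' _; rewrite /h/= st mul1r.
  rewrite integral0_eq; last by move=> w' _; rewrite /h/= ltNge ts mul0r mule0.
  rewrite [X in _ * X]integral0_eq ?mule0// => w' _.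
  rewrite /Theta integral0_eq// => x _; rewrite /k/= gauss_le0 ?mulr0//.
  exact: bridge_variance_le0.
rewrite ge0_integralZl//; last by move=> w _; exact: integral_ge0.
congr (_ * _).
have := independent_integral mtau mid indep mTheta Theta0 => <-.
have mk2 : measurable_fun setT (fun z : T * R => k ((tau z.1, z.1), z.2)).
  exact: (measurableT_comp mk (measurable_fun_pair (measurable_fun_pair
    (measurableT_comp mtau measurable_fst) (measurableT_comp mid measurable_fst))
    measurable_snd)).
have := fubini_tonelli (m1 := P) (m2 := mu) (fun z : T * R => k ((tau z.1, z.1), z.2)) mk2.
rewrite /= => -> //.
apply: eq_integral => x _; rewrite /bridge_density.
have mb : measurable_fun setT (fun w => (g (beta u w) *
    gauss (bridge_variance s u (tau w)) (x - s / u * beta u w))%:E).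
  have mbu := measurable_information hW (ltW u0) mtau.
  apply/measurable_EFinP; apply: measurable_funM; first exact: (measurableT_comp mg).
  apply: measurable_gauss; first exact: (measurableT_comp (measurable_bridge_variance s u)).
  by apply: measurable_funB => //; exact: measurable_funM.
rewrite -ge0_integralZl//; last by rewrite lee_fin.
by move=> w _; rewrite lee_fin mulr_ge0 ?gauss_ge0.
Qed.

End bridge_kernel.

(** * The Markov property at a fixed positive time *)

Section markov_fixed_time.
Context {R : realType} {d} {T : measurableType d} (P : probability T R).
Variables (W : R -> T -> R) (hW : standard_brownian_motion P W).
Variables (tau : T -> R) (mtau : measurable_fun setT tau) (tau0 : forall w, 0 < tau w).
Hypothesis hind : independent_systems P (g_sigma_algebra_preimage tau)
  (sigma_process `[0, +oo[ W).
Local Notation mu := (@lebesgue_measure R).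
Local Notation beta := (information_process W tau).
Local Notation density := (bridge_density P W tau).
Local Open Scope ereal_scope.

Let mbeta s : (0 <= s)%R -> measurable_fun setT (beta s).
Proof. by move=> s0; exact: (measurable_information hW). Qed.

Lemma information_absorbed s w : (0 < s)%R -> (tau w <= s)%R -> beta s w = 0%R.
Proof.
move=> s0 ts; rewrite /information_process max_r// divff ?gt_eqF//.
by rewrite mul1r subrr.
Qed.

Lemma information_nonzero s w : (0 < s)%R -> beta s w != 0%R -> (s < tau w)%R.
Proof.
by move=> s0; apply: contraNT; rewrite -leNgt => ts; rewrite information_absorbed.
Qed.

(** One summand for each regime. When [tau <= u] the value [beta u] is 0 and the variance may be
    arbitrarily small, so only [|x|^-1] is available; when [u < tau] the variance no longer depends
    on [tau]. *)
Definition density_bound (s u x : R) : R :=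
  (`|x|^-1 + (Num.sqrt (s * (u - s) / u))^-1)%R.

Lemma density_bound_ge0 s u x : (0 <= density_bound s u x)%R.
Proof. by rewrite addr_ge0// invr_ge0. Qed.

Lemma gauss_density_bound s u x w : (0 < s)%R -> (s < u)%R -> x != 0%R ->
  (gauss (bridge_variance s u (tau w)) (x - s / u * beta u w) <= density_bound s u x)%R.
Proof.
move=> s0 su x0; have u0 := lt_trans s0 su.
have [tu|ut] := leP (tau w) u.
  rewrite (information_absorbed u0 tu) mulr0 subr0.
  apply: (@le_trans _ _ (`|x|^-1)%R); last by rewrite lerDl invr_ge0.
  by rewrite -[leRHS]mul1r ler_pdivlMr ?normr_gt0// gauss_ub_norm.
rewrite /bridge_variance (min_l (ltW ut)).
apply: (@le_trans _ _ ((Num.sqrt (s * (u - s) / u))^-1)%R); last by rewrite lerDr invr_ge0.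
by apply: gauss_ub; rewrite divr_gt0// mulr_gt0// subr_gt0.
Qed.

Section density_facts.
Variables (g : R -> R) (mg : measurable_fun setT g) (g0 : forall x, (0 <= g x)%R).

Lemma measurable_weighted_gauss s u : (0 < u)%R ->
  measurable_fun setT (fun z : R * T => (g (beta u z.2) *
    gauss (bridge_variance s u (tau z.2)) (z.1 - s / u * beta u z.2))%:E).
Proof.
move=> u0; have mbu := mbeta (ltW u0).
have mbu2 := measurableT_comp mbu (@measurable_snd _ _ R T).
apply/measurable_EFinP; apply: measurable_funM; first exact: (measurableT_comp mg mbu2).
apply: measurable_gauss.
  apply: (measurableT_comp (measurable_bridge_variance s u)).
  exact: (measurableT_comp mtau measurable_snd).
by apply: measurable_funB; [exact: measurable_fst|exact: measurable_funM].
Qed.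

Lemma measurable_weighted_gauss1 s u x : (0 < u)%R ->
  measurable_fun setT (fun w => (g (beta u w) *
    gauss (bridge_variance s u (tau w)) (x - s / u * beta u w))%:E).
Proof.
move=> u0; exact: (measurableT_comp (measurable_weighted_gauss s u0) (measurable_pair1 x)).
Qed.

Lemma measurable_bridge_density s u : (0 < u)%R ->
  measurable_fun setT (density g s u).
Proof.
move=> u0; have mk := measurable_weighted_gauss s u0.
apply: (measurable_fun_fubini_tonelli_F (m2 := P) _ mk) => z.
by rewrite lee_fin mulr_ge0 ?gauss_ge0.
Qed.

Lemma bridge_density_ge0 s u x : 0 <= density g s u x.
Proof. by apply: integral_ge0 => w _; rewrite lee_fin mulr_ge0 ?gauss_ge0. Qed.

Lemma bridge_density_le s u x : (0 < s)%R -> (s < u)%R -> x != 0%R ->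
  density g s u x <= (density_bound s u x)%:E * \int[P]_w (g (beta u w))%:E.
Proof.
move=> s0 su x0; have u0 := lt_trans s0 su.
have mgb : measurable_fun setT (fun w => (g (beta u w))%:E).
  by apply/measurable_EFinP; exact: (measurableT_comp mg (mbeta (ltW u0))).
rewrite -ge0_integralZl//; last 2 first.
- by move=> w _; rewrite lee_fin.
- by rewrite lee_fin density_bound_ge0.
apply: ge0_le_integral => //.
- by move=> w _; rewrite lee_fin mulr_ge0 ?gauss_ge0.
- exact: measurable_weighted_gauss1.
- by apply: measurable_funeM.
- move=> w _; rewrite -EFinM lee_fin mulrC.
  by apply: ler_wpM2r => //; exact: gauss_density_bound.
Qed.

End density_facts.

(** At 0 the process is almost surely absorbed, hence the value [g 0]; elsewhere this is Bayes'
    formula. *)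
Definition markov_kernel (g : R -> R) (s u x : R) : R :=
  if x == 0%R then g 0%R else (fine (density g s u x) / fine (density (cst 1%R) s u x))%R.

Let m1 : measurable_fun setT (cst 1%R : R -> R). Proof. exact: measurable_cst. Qed.
Let c10 x : (0 <= (cst 1%R : R -> R) x)%R. Proof. exact: ler01. Qed.

Lemma measurable_markov_kernel (g : R -> R) s u : (0 < u)%R -> measurable_fun setT g ->
  (forall x, 0 <= g x)%R -> measurable_fun setT (markov_kernel g s u).
Proof.
move=> u0 mg g0; have mfine : measurable_fun setT (@fine R) by [].
apply: measurable_fun_ifT => //.
  exact: measurable_fun_eqr.
apply: measurable_funM.
  by apply: (measurableT_comp mfine); exact: measurable_bridge_density.
apply: (measurableT_comp measurable_invr).
by apply: (measurableT_comp mfine); exact: measurable_bridge_density.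
Qed.

Lemma markov_kernel_ge0 (g : R -> R) s u x : (forall x, 0 <= g x)%R -> (0 <= markov_kernel g s u x)%R.
Proof.
by move=> g0; rewrite /markov_kernel; case: ifP => // _; rewrite divr_ge0// fine_ge0// bridge_density_ge0.
Qed.

Lemma bridge_density_fin (g : R -> R) s u x : (0 < s)%R -> (s < u)%R -> x != 0%R ->
  measurable_fun setT g -> (forall x, 0 <= g x)%R ->
  \int[P]_w (g (beta u w))%:E < +oo -> density g s u x \is a fin_num.
Proof.
move=> s0 su x0 mg g0 ig; rewrite ge0_fin_numE ?bridge_density_ge0//.
apply: le_lt_trans (bridge_density_le mg g0 s0 su x0) _.
by rewrite lte_mul_pinfty// lee_fin density_bound_ge0.
Qed.

Lemma bridge_density1_fin s u x : (0 < s)%R -> (s < u)%R -> x != 0%R ->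
  density (cst 1%R) s u x \is a fin_num.
Proof.
move=> s0 su x0; apply: bridge_density_fin => //=.
by rewrite integral_cst//= mul1e probability_setT ltry.
Qed.

(** Where the denominator vanishes, the nonnegative Gaussian factor is almost surely 0, so the
    numerator vanishes too and the value given to the quotient does not matter. *)
Lemma markov_kernelE (g : R -> R) s u x : (0 < s)%R -> (s < u)%R -> x != 0%R ->
  measurable_fun setT g -> (forall x, 0 <= g x)%R ->
  \int[P]_w (g (beta u w))%:E < +oo ->
  (markov_kernel g s u x)%:E * density (cst 1%R) s u x = density g s u x.
Proof.
move=> s0 su x0 mg g0 ig; rewrite /markov_kernel (negbTE x0).
have fq := bridge_density1_fin s0 su x0.
have fk := bridge_density_fin s0 su x0 mg g0 ig.
have [q0|q0] := eqVneq (density (cst 1%R) s u x) 0; last first.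
  rewrite -{2}(fineK fq) -EFinM divfK ?fineK//.
  by apply: contra_neq q0 => q0; rewrite -(fineK fq) q0.
rewrite q0 mule0; apply/esym.
have u0 := lt_trans s0 su.
have mk1 := measurable_weighted_gauss1 m1 s x u0.
have : ae_eq P setT (fun w => (cst 1 (beta u w) *
    gauss (bridge_variance s u (tau w)) (x - s / u * beta u w))%:E) (cst 0).
  apply: (ae_eq_integral_abs P measurableT mk1).1 => //.
  under eq_integral do rewrite gee0_abs ?lee_fin ?mulr_ge0 ?gauss_ge0//.
  exact: q0.
move=> ae0; rewrite /bridge_density (ae_eq_integral (cst 0))//.
- by rewrite integral0.
- exact: measurable_weighted_gauss1.
- apply: filterS ae0 => w /= h _; have := h I.
  by rewrite mul1r => -[->]; rewrite mulr0.
Qed.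

Definition bridge_generators s : set (set T) :=
  \bigcup_(r in `]0%R, s]) g_sigma_algebra_preimage (inverted_increment W s r).

Lemma bridge_generators_measurable s : bridge_generators s `<=` measurable.
Proof.
move=> A [r]; rewrite /= in_itv/= => /andP[r0 rs]; move: A.
apply: sub_preimage_measurable; have s0 := lt_le_trans r0 rs.
by apply: measurable_funB; apply: measurable_funM => //; apply: (bm_measurable hW); exact: ltW.
Qed.

(* While [beta s != 0] we have [s < tau], and then [beta r / r - beta s / s] is an
   increment of the inverted motion for every [r <= s]. *)
Lemma natural_filtration_trace s A : (0 < s)%R -> natural_filtration beta s A ->
  exists2 A', <<s bridge_generators s `|` g_sigma_algebra_preimage (beta s) >> A' &
    A `&` [set w | beta s w != 0%R] = A' `&` [set w | beta s w != 0%R].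
Proof.
move=> s0; set G := bridge_generators s `|` _; set E := [set w | _].
pose TG := g_sigma_algebraType G.
(* The events with the wanted trace form a sigma-algebra, so generators suffice. *)
pose H := [set A | exists2 A', <<s G >> A' & A `&` E = A' `&` E].
suff : natural_filtration beta s `<=` H by move/(_ A).
apply: sigma_process_sub.
  split.
  - by exists set0 => //; exact: (@measurable0 _ TG).
  - move=> B [B' GB' BE]; exists (~` B'); first exact: (@measurableC _ TG).
    rewrite setTD; apply/seteqP; split => w [nB Ew]; split => // Bw; apply: nB.
      by have [] : (B `&` E) w by rewrite BE.
    by have [] : (B' `&` E) w by rewrite -BE.
  - move=> F HF; have /choice[F' HF'] : forall n, exists F'n, <<s G >> F'n /\ F n `&` E = F'n `&` E.
      by move=> n; have [F'n ? ?] := HF n; exists F'n.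
    exists (\bigcup_n F' n).
      by apply: (@bigcupT_measurable _ TG) => n; have [] := HF' n.
    by rewrite !setI_bigcupl; apply: eq_bigcupr => n _; have [] := HF' n.
(* At [r = 0] the process is 0, so a preimage is empty or everything. *)
move=> r; rewrite /= in_itv/= => /andP[]; rewrite le_eqVlt => /orP[/eqP <- _|r0 rs].
  move=> _ [B mB <-]; rewrite setTI.
  have [B0|B0] := boolP (0%R \in B).
    exists setT; first exact: (@measurableT _ TG).
    congr (_ `&` _); apply/seteqP; split => // w _ /=.
    by move: B0; rewrite inE /information_process (bm_start hW) mul0r mul0r subr0.
  exists set0; first exact: (@measurable0 _ TG).
  congr (_ `&` _); apply/seteqP; split => // w /=.
  rewrite /information_process (bm_start hW) mul0r mul0r subr0 => B0'.
  by move/negP : B0; rewrite inE.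
move=> _ [B mB <-]; rewrite setTI.
pose X w := (r * inverted_increment W s r w + r / s * beta s w)%R.
have mX : measurable_fun setT (X : TG -> R).
  apply: measurable_funD; apply: measurable_funM => //.
    apply/measurable_g_sigmaP => C HC; apply: sub_sigma_algebra; left; exists r => //.
    by rewrite /= in_itv/= r0.
  by apply/measurable_g_sigmaP => C HC; apply: sub_sigma_algebra; right.
exists (X @^-1` B); first by rewrite -[X in <<s G >> X]setTI; exact: mX.
have XE w : E w -> beta r w = X w.
  move=> /(information_nonzero s0) st.
  rewrite /X /inverted_increment /information_process !max_l ?ltW ?(le_lt_trans rs)//.
  by field; rewrite !gt_eqF// ?(lt_trans s0).
by apply/seteqP; split => w [/= Bw Ew]; split => //=; [rewrite -XE|rewrite XE].
Qed.

End markov_fixed_time.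

Section markov_fixed_time_integral.
Context {R : realType} {d} {T : measurableType d} (P : probability T R).
Variables (W : R -> T -> R) (hW : standard_brownian_motion P W).
Variables (tau : T -> R) (mtau : measurable_fun setT tau) (tau0 : forall w, 0 < tau w).
Hypothesis hind : independent_systems P (g_sigma_algebra_preimage tau)
  (sigma_process `[0, +oo[ W).
Local Notation mu := (@lebesgue_measure R).
Local Notation beta := (information_process W tau).
Local Notation density := (bridge_density P W tau).
Local Notation kernel := (markov_kernel P W tau).
Local Open Scope ereal_scope.

Let mbeta s : (0 <= s)%R -> measurable_fun setT (beta s).
Proof. by move=> s0; exact: (measurable_information hW). Qed.

Let m1 : measurable_fun setT (cst 1%R : R -> R). Proof. exact: measurable_cst. Qed.
Let c10 x : (0 <= (cst 1%R : R -> R) x)%R. Proof. exact: ler01. Qed.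

(** The density identity with [psi] the indicator of 0 shows that [s < tau] and [beta s = 0] hold
    together with probability 0, as a point is Lebesgue-null. The later time [s + 1] is
    arbitrary. *)
Lemma information_zero_ae s : (0 < s)%R ->
  {ae P, forall w, beta s w = 0%R -> (tau w <= s)%R}.
Proof.
move=> s0; have su : (s < s + 1)%R by rewrite ltrDl.
have mz : measurable [set 0%R : R] by exact: measurable_set1.
have := information_density_integral hW mtau tau0 hind s0 su
  (@sub_sigma_setT _ T _ : bridge_algebra W s setT) m1 (measurable_indic mz) c10
  (fun x => ler0n _ _).
pose E := [set w | (s < tau w)%R] `&` beta s @^-1` [set 0%R].
have mE : measurable E.
  apply: measurableI; last by rewrite -[X in measurable X]setTI; exact: mbeta (ltW s0) _ _ mz.
  rewrite (_ : [set w | _] = tau @^-1` `]s, +oo[); last first.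
    by apply/seteqP; split => w /=; rewrite in_itv/= andbT.
  by rewrite -[X in measurable X]setTI; apply: mtau.
have -> : \int[P]_w ((\1_[set: T] w)%:E * ((s < tau w)%R%:R *
    (cst 1 (beta (s + 1) w) * \1_[set 0%R] (beta s w)))%:E) = P E.
  rewrite -[in RHS](setIT E) -integral_indic//; apply: eq_integral => w _.
  rewrite indicT mul1e mul1r !indicE -natrM mulnb; congr (_%:R%:E).
  by congr nat_of_bool; apply/andP/idP; rewrite !inE.
rewrite probability_setT mul1e.
rewrite (_ : \int[mu]_x _ = 0); last first.
  transitivity (\int[mu]_(x in [set 0%R]) density (cst 1%R) s (s + 1) x).
    rewrite [RHS]integral_mkcond; apply: eq_integral => x _.
    by rewrite epatch_indic muleC.
  apply: null_set_integral; [exact: measurable_set1| |exact: lebesgue_measure_set1].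
  apply: measurable_funTS; apply: (measurable_bridge_density hW mtau m1 c10); exact: addr_gt0.
move=> PE; exists E; split => // w /= h; split.
  by rewrite /= ltNge; apply/negP => ts; apply: h.
by apply: contrapT => bs; apply: h => /bs.
Qed.

Section fixed_times.
Variables (s u : R) (g : R -> R).
Hypotheses (s0 : (0 < s)%R) (su : (s < u)%R).
Hypotheses (mg : measurable_fun setT g) (g0 : forall x, (0 <= g x)%R).
Hypothesis ig : \int[P]_w (g (beta u w))%:E < +oo.

Let u0 : (0 < u)%R. Proof. exact: lt_trans su. Qed.
Let ne (x : R) : R := (x != 0%R)%:R.
Let f1 w := (ne (beta s w) * g (beta u w))%:E.
Let f2 w := (ne (beta s w) * kernel g s u (beta s w))%:E.

Let mne : measurable_fun setT ne.
Proof.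
rewrite (_ : ne = \1_(~` [set 0%R])); first by apply: measurable_indic; apply: measurableC; exact: measurable_set1.
apply/funext => x; rewrite indicE in_setC /ne; congr (~~ _)%:R.
by apply/eqP/idP; rewrite inE.
Qed.

Let mgu : measurable_fun setT (fun w => g (beta u w)).
Proof. exact: (measurableT_comp mg (mbeta (ltW u0))). Qed.

Let mkernel : measurable_fun setT (kernel g s u).
Proof. exact: measurable_markov_kernel. Qed.

Let kernel0 x : (0 <= kernel g s u x)%R.
Proof. exact: markov_kernel_ge0. Qed.

Let mf1 : measurable_fun setT f1.
Proof.
apply/measurable_EFinP; apply: measurable_funM => //.
exact: (measurableT_comp mne (mbeta (ltW s0))).
Qed.

Let mf2 : measurable_fun setT f2.
Proof.
apply/measurable_EFinP; apply: measurable_funM.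
  exact: (measurableT_comp mne (mbeta (ltW s0))).
exact: (measurableT_comp mkernel (mbeta (ltW s0))).
Qed.

Let f10 w : 0 <= f1 w. Proof. by rewrite lee_fin mulr_ge0. Qed.
Let f20 w : 0 <= f2 w. Proof. by rewrite lee_fin mulr_ge0. Qed.

(** By [information_density_integral] both sides are [P D] times an integral over [C] without 0; the
    integrands agree by [markov_kernelE]. *)
Let rectangle_integral D C : bridge_algebra W s D -> measurable C ->
  \int[P]_(w in D `&` beta s @^-1` C) f1 w = \int[P]_(w in D `&` beta s @^-1` C) f2 w.
Proof.
move=> HD mC.
have mCi := measurable_indic mC : measurable_fun setT (\1_C : R -> R).
have K1 := information_density_integral hW mtau tau0 hind s0 su HD mg
  (measurable_funM mCi mne : measurable_fun setT (fun x => \1_C x * ne x)%R) g0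
  (fun x => mulr_ge0 (ler0n _ _) (ler0n _ _)).
have K2 := information_density_integral hW mtau tau0 hind s0 su HD m1
  (measurable_funM (measurable_funM mCi mne) mkernel :
    measurable_fun setT (fun x => \1_C x * ne x * kernel g s u x)%R) c10
  (fun x => mulr_ge0 (mulr_ge0 (ler0n _ _) (ler0n _ _)) (kernel0 x)).
have indI w : \1_(D `&` beta s @^-1` C) w = (\1_D w * \1_C (beta s w))%R.
  by rewrite !indicE in_setI -natrM mulnb.
(* The indicator of [s < tau] is absorbed, because a nonzero value forces [s < tau]. *)
have neE w : ((s < tau w)%R%:R * ne (beta s w))%R = ne (beta s w).
  rewrite /ne; have [b0|b0] := eqVneq (beta s w) 0%R; first by rewrite mulr0.
  by rewrite (information_nonzero s0 b0) mul1r.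
transitivity (\int[P]_w ((\1_D w)%:E * ((s < tau w)%R%:R *
    (g (beta u w) * (\1_C (beta s w) * ne (beta s w))))%:E)).
  rewrite integral_mkcond; apply: eq_integral => w _.
  rewrite epatch_indic /= indI /f1 -!EFinM -[in LHS]neE; congr EFin; ring.
rewrite K1; apply: etrans; last first.
  transitivity (\int[P]_w ((\1_D w)%:E * ((s < tau w)%R%:R * (cst 1 (beta u w) *
      (\1_C (beta s w) * ne (beta s w) * kernel g s u (beta s w))))%:E)); last first.
    apply/esym; rewrite integral_mkcond; apply: eq_integral => w _.
    rewrite epatch_indic /= indI /f2 -!EFinM -[in LHS]neE /cst; congr EFin; ring.
  exact/esym/K2.
congr (_ * _); apply: eq_integral => x _.
rewrite /ne; have [->|x0] := eqVneq x 0%R; first by rewrite !mulr0 mul0r !mul0e.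
by rewrite mulr1 [in RHS]EFinM -muleA (markov_kernelE hW) .
Qed.

Let if1 : P.-integrable setT f1.
Proof.
apply/integrableP; split => //.
apply: le_lt_trans ig; apply: ge0_le_integral => //.
- exact: measurableT_comp.
- by apply/measurable_EFinP.
- move=> w _; rewrite gee0_abs// lee_fin ler_piMl// /ne.
  by case: (_ != _).
Qed.

Let if2 : P.-integrable setT f2.
Proof.
apply/integrableP; split => //.
(* Integrability of the kernel term comes from the identity on the whole space. *)
have := rectangle_integral (@sub_sigma_setT _ T _ : bridge_algebra W s setT) measurableT.
rewrite preimage_setT setTI => e.
under eq_integral do rewrite gee0_abs//.
rewrite -e; move/integrableP : if1 => [_].
by under eq_integral do rewrite gee0_abs//.
Qed.

Let g_sigma_integral A :
  <<s bridge_generators W s `|` g_sigma_algebra_preimage (beta s) >> A ->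
  \int[P]_(w in A) f1 w = \int[P]_(w in A) f2 w.
Proof.
pose C := [set D `&` beta s @^-1` B | D in bridge_algebra W s & B in (measurable : set (set R))].
have mB : bridge_algebra W s `<=` measurable.
  by apply: sub_g_sigma_measurable; exact: (bridge_generators_measurable hW).
move=> HA; apply: (@integral_eq_g_sigma _ _ _ P C) => //.
- move=> _ _ [D HD [B mB1 <-]] [D' HD' [B' mB' <-]].
  exists (D `&` D'); first exact: sub_sigma_setI.
  by exists (B `&` B'); [exact: measurableI|rewrite preimage_setI setIACA].
- exists setT; first exact: (@sub_sigma_setT _ T).
  by exists setT => //; rewrite preimage_setT setIT.
- move=> _ [D HD [B mB1 <-]]; apply: measurableI; first exact: mB.
  by rewrite -[X in measurable X]setTI; exact: mbeta (ltW s0) _ _ mB1.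
- by move=> _ [D HD [B mB1 <-]]; exact: rectangle_integral.
- apply: (smallest_sub (smallest_sigma_algebra _ _) _) HA.
  rewrite subUset; split => [D HD|_ [B mB1 <-]]; apply: sub_sigma_algebra.
    exists D; first exact: sub_sigma_algebra.
    by exists setT => //; rewrite preimage_setT setIT.
  by exists setT; [exact: (@sub_sigma_setT _ T)|exists B].
Qed.

Lemma natural_filtration_measurable r : natural_filtration beta r `<=` measurable.
Proof.
by apply: sigma_process_measurable => q /=; rewrite in_itv/= => /andP[q0 _]; exact: mbeta.
Qed.

Lemma markov_fixed_time A : natural_filtration beta s A ->
  \int[P]_(w in A) (g (beta u w))%:E = \int[P]_(w in A) (kernel g s u (beta s w))%:E.
Proof.
move=> FA; have mA := natural_filtration_measurable FA.
have [A' GA' AE] := natural_filtration_trace hW tau0 s0 FA.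
(* The contribution of [beta s = 0]: almost surely [tau <= s] there, so [beta u] is also 0. *)
pose r w := ((1 - ne (beta s w)) * g 0)%:E.
have mr : measurable_fun setT r.
  apply/measurable_EFinP; apply: measurable_funM => //; apply: measurable_funB => //.
  exact: (measurableT_comp mne (mbeta (ltW s0))).
have ne1 x : (0 <= 1 - ne x)%R by rewrite subr_ge0 /ne; case: (_ != _).
have r0 w : 0 <= r w by rewrite lee_fin mulr_ge0.
transitivity (\int[P]_(w in A) (f1 w + r w)).
  apply: ae_eq_integral => //.
  - by apply: measurable_funTS; exact/measurable_EFinP.
  - by apply: measurable_funTS; exact: emeasurable_funD.
  - apply: filterS (information_zero_ae s0) => w h _.
    rewrite /f1 /r -EFinD /ne; congr EFin.
    have [b0|b0] := eqVneq (beta s w) 0%R; last by rewrite mul1r subrr mul0r addr0.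
    rewrite mul0r add0r subr0 mul1r (@information_absorbed _ _ _ _ _ u)//.
    by rewrite (le_trans (h b0))// ltW.
transitivity (\int[P]_(w in A) (f2 w + r w)); last first.
  apply: eq_integral => w _; rewrite /f2 /r -EFinD /ne; congr EFin.
  have [->|b0] := eqVneq (beta s w) 0%R; last by rewrite mul1r subrr mul0r addr0.
  by rewrite mul0r add0r subr0 mul1r /markov_kernel eqxx.
rewrite !ge0_integralD//; try exact: measurable_funTS.
congr (_ + _); rewrite !(integral_mkcond A).
(* The factor [ne] restricts the integrals to [beta s != 0], where [A] may be replaced by its trace
   representative [A']. *)
have patchE (f : T -> R) : (fun w => (ne (beta s w) * f w)%:E) \_ A =
    (fun w => (ne (beta s w) * f w)%:E) \_ A'.
  apply/funext => w; rewrite !patchE /ne.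
  have [b0|b0] := eqVneq (beta s w) 0%R; first by rewrite mul0r !if_same.
  have -> // : (w \in A) = (w \in A').
  apply/idP/idP; rewrite !inE => Aw.
    by have [] : (A' `&` [set w | beta s w != 0%R]) w by rewrite -AE.
  by have [] : (A `&` [set w | beta s w != 0%R]) w by rewrite AE.
rewrite /f1 /f2 (patchE (fun w => g (beta u w))) (patchE (fun w => kernel g s u (beta s w))).
rewrite -!integral_mkcond; exact: g_sigma_integral.
Qed.

End fixed_times.

End markov_fixed_time_integral.

(** * Passage to the limit in integrals over a fixed event *)

Section integral_limits.
Context {R : realType} {d} {T : measurableType d} (P : probability T R).
Local Open Scope ereal_scope.

Lemma measurable_limn_einf (f : (T -> \bar R)^nat) :
  (forall n, measurable_fun setT (f n)) ->
  measurable_fun setT (fun x => limn_einf (f^~ x)).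
Proof.
move=> mf; have -> : (fun x => limn_einf (f^~ x)) =
    (fun x => - limn_esup ((fun n y => - f n y)^~ x)).
  apply/funext => x; rewrite -[fun x0 => - f x0 x]/(-%E \o f^~ x).
  by rewrite limn_esupN oppeK.
apply: measurableT_comp => //; apply: measurable_fun_limn_esup => n.
exact: measurableT_comp.
Qed.

(* Fatou's lemma on [A] and on its complement; the total masses agree, so both
   inequalities are equalities. *)
Lemma fatou_eq (h_ : (T -> \bar R)^nat) (h f : T -> \bar R) (A : set T) :
  (forall n, measurable_fun setT (h_ n)) -> measurable_fun setT h ->
  measurable_fun setT f ->
  (forall n w, 0 <= h_ n w) -> (forall w, 0 <= h w) -> (forall w, 0 <= f w) ->
  {ae P, forall w, h_ n w @[n --> \oo] --> h w} ->
  measurable A ->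
  (forall n, \int[P]_(w in A) h_ n w = \int[P]_(w in A) f w) ->
  (forall n, \int[P]_(w in ~` A) h_ n w = \int[P]_(w in ~` A) f w) ->
  \int[P]_w h w = \int[P]_w f w -> \int[P]_w f w < +oo ->
  \int[P]_(w in A) h w = \int[P]_(w in A) f w.
Proof.
move=> mh_ mh mf h_0 h0 f0 h_h mA hA hAc hf foo.
have le_int B : measurable B ->
    (forall n, \int[P]_(w in B) h_ n w = \int[P]_(w in B) f w) ->
    \int[P]_(w in B) h w <= \int[P]_(w in B) f w.
  move=> mB hB.
  have -> : \int[P]_(w in B) h w = \int[P]_(w in B) limn_einf (h_^~ w).
    apply: ae_eq_integral => //.
    - exact: measurable_funTS.
    - by apply: measurable_funTS; exact: measurable_limn_einf.
    - by apply: filterS h_h => w hw _; rewrite (cvg_limn_einf_sup hw).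
  apply: le_trans (fatou P mB _ _) _ => //; first by move=> n; exact: measurable_funTS.
  under eq_fun do rewrite hB.
  by rewrite (cvg_limn_einf_sup (cvg_cst _)).
have split_int (k : T -> \bar R) : measurable_fun setT k -> (forall w, 0 <= k w) ->
    \int[P]_w k w = \int[P]_(w in A) k w + \int[P]_(w in ~` A) k w.
  move=> mk k0; rewrite -ge0_integral_setU//.
  - by rewrite setUv.
  - exact: measurableC.
  - by rewrite setUv.
  - by rewrite disj_set2E setICr.
apply/eqP; rewrite eq_le le_int//=.
have hAc' := le_int _ (measurableC mA) hAc.
have fAc : \int[P]_(w in ~` A) f w \is a fin_num.
  rewrite ge0_fin_numE; last exact: integral_ge0.
  by apply: le_lt_trans foo; rewrite (split_int f)// leeDr// integral_ge0.
have hAcf : \int[P]_(w in ~` A) h w \is a fin_num.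
  rewrite ge0_fin_numE; last exact: integral_ge0.
  by apply: le_lt_trans hAc' _; rewrite -ge0_fin_numE// integral_ge0.
rewrite -(leeD2rE _ _ hAcf) -split_int// hf (split_int f)//.
by rewrite leeD2l.
Qed.

End integral_limits.

(** * From fixed times to the right limit at a positive time *)

Section markov_right_limit.
Context {R : realType} {d} {T : measurableType d} (P : probability T R).
Variables (W : R -> T -> R) (hW : standard_brownian_motion P W).
Variables (tau : T -> R) (mtau : measurable_fun setT tau) (tau0 : forall w, 0 < tau w).
Hypothesis hind : independent_systems P (g_sigma_algebra_preimage tau)
  (sigma_process `[0, +oo[ W).
Local Notation beta := (information_process W tau).
Local Notation density := (bridge_density P W tau).
Local Notation kernel := (markov_kernel P W tau).

Let mbeta s : (0 <= s)%R -> measurable_fun setT (beta s).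
Proof. by move=> s0; exact: (measurable_information hW). Qed.

Let m1 : measurable_fun setT (cst 1%R : R -> R). Proof. exact: measurable_cst. Qed.
Let c10 x : (0 <= (cst 1%R : R -> R) x)%R. Proof. exact: ler01. Qed.

Lemma information_cvg (s_ : nat -> R) (t : R) (w : T) :
  (forall n, 0 <= s_ n) -> 0 <= t -> s_ n @[n --> \oo] --> t ->
  beta (s_ n) w @[n --> \oo] --> beta t w.
Proof.
move=> s0 t0 st; rewrite /information_process.
have mx : Num.max (tau w) (s_ n) @[n --> \oo] --> Num.max (tau w) t.
  by rewrite maxC; under eq_fun do rewrite maxC; exact: cvg_maxr_cst.
have tw := tau0 w.
apply: cvgB; first exact: (BM_cvg hW).
apply: cvgM.
  by apply: cvgM => //; apply: cvgV => //; rewrite gt_eqF// lt_max tw.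
apply: (BM_cvg hW) => // [n|]; by rewrite le_max ltW.
Qed.

Lemma bridge_density_cvg (g : R -> R) (s_ x_ : nat -> R) (t s1 u x e : R) :
  measurable_fun setT g -> (forall x, 0 <= g x) ->
  (\int[P]_w (g (beta u w))%:E < +oo)%E ->
  0 < t -> s1 < u -> (forall n, t < s_ n <= s1) -> s_ n @[n --> \oo] --> t ->
  0 < e -> (forall n, e <= `|x_ n|) -> x_ n @[n --> \oo] --> x ->
  (density g (s_ n) u (x_ n) @[n --> \oo] --> density g t u x)%E.
Proof.
move=> mg g0 ig t0 s1u ts st e0 xe xx.
have ts1 : t < s1 by have /andP[h1 h2] := ts 0%N; exact: lt_le_trans h2.
have s10 := lt_trans t0 ts1; have u0 := lt_trans s10 s1u; have tu := lt_trans ts1 s1u.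
(* A bound on [density_bound] uniform in [n]: [|x_ n|] is at least [e], and [s_ n * (u - s_ n)] is
   at least [t * (u - s1)]. *)
pose B := e^-1 + (Num.sqrt (t * (u - s1) / u))^-1.
have B0 : 0 <= B by rewrite addr_ge0// invr_ge0// ltW.
have mgu : measurable_fun setT (fun w => (g (beta u w))%:E).
  by apply/measurable_EFinP; exact: (measurableT_comp mg (mbeta (ltW u0))).
have := @dominated_convergence _ _ _ P setT measurableT
  (fun n w => (g (beta u w) * gauss (bridge_variance (s_ n) u (tau w))
     (x_ n - s_ n / u * beta u w))%:E)
  (fun w => (g (beta u w) * gauss (bridge_variance t u (tau w)) (x - t / u * beta u w))%:E)
  (fun w => (B%:E * (g (beta u w))%:E)%E).
case=> //.
- by move=> n; exact: (measurable_weighted_gauss1 hW mtau mg).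
- exact: (measurable_weighted_gauss1 hW mtau mg).
- apply: aeW => w _; apply: cvg_EFin; first exact: nearW.
  (* Gaussian densities converge when the limit variance is positive, that is when [t < tau w];
     otherwise all terms are 0. *)
  apply: cvgMr; have [tw|wt] := ltP t (tau w).
    apply: cvg_gauss; first exact: bridge_variance_gt0.
      by apply: cvgMl; apply: cvgM => //; apply: cvgB => //; exact: cvg_cst.
    by apply: cvgB => //; apply: cvgMl; exact: cvgMl.
  rewrite (gauss_le0 _ (bridge_variance_le0 t0 tu (tau0 w) wt)).
  rewrite (_ : (fun n => _) = cst 0); first exact: cvg_cst.
  apply/funext => n; have /andP[tn ns1] := ts n.
  rewrite gauss_le0//; apply: bridge_variance_le0 => //.
  + exact: lt_trans tn.
  + exact: le_lt_trans s1u.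
  + by rewrite (le_trans wt)// ltW.
- apply/integrableP; split; first exact: measurable_funeM.
  under eq_integral do rewrite gee0_abs ?mule_ge0 ?lee_fin//.
  rewrite ge0_integralZl ?lee_fin//; first by rewrite lte_mul_pinfty ?lee_fin.
  by move=> w _; rewrite lee_fin.
- apply: aeW => w n _; have /andP[tn ns1] := ts n.
  have n0 := lt_trans t0 tn; have nu := le_lt_trans ns1 s1u.
  rewrite gee0_abs ?lee_fin ?mulr_ge0 ?gauss_ge0//.
  rewrite mulrC; apply: ler_wpM2r => //.
  have xn0 : x_ n != 0 by rewrite -normr_gt0; exact: lt_le_trans (xe n).
  apply: le_trans (gauss_density_bound W tau w n0 nu xn0) _.
  apply: lerD.
    by rewrite lef_pV2 ?posrE ?normr_gt0.
  have pt : 0 < t * (u - s1) / u by rewrite divr_gt0// mulr_gt0// subr_gt0.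
  have pn : 0 < s_ n * (u - s_ n) / u by rewrite divr_gt0// mulr_gt0// subr_gt0.
  rewrite lef_pV2 ?posrE ?sqrtr_gt0//; apply: ler_wsqrtr.
  apply: ler_wpM2r; first by rewrite invr_ge0 ltW.
  apply: ler_pM; rewrite ?subr_ge0 ?lerD2l ?lerN2//; exact: ltW.
Qed.

(** The integrand is positive wherever [s < tau], so a single zero of the denominator forces
    absorption almost surely. *)
Lemma bridge_density1_eq0 s u x : 0 < s -> s < u ->
  density (cst 1) s u x = 0%E -> {ae P, forall w, tau w <= s}.
Proof.
move=> s0 su q0; have u0 := lt_trans s0 su.
have mk1 := measurable_weighted_gauss1 hW mtau m1 s x u0.
have : ae_eq P setT (fun w => (cst 1 (beta u w) *
    gauss (bridge_variance s u (tau w)) (x - s / u * beta u w))%:E) (cst 0)%E.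
  apply: (ae_eq_integral_abs P measurableT mk1).1 => //.
  under eq_integral do rewrite gee0_abs ?lee_fin ?mulr_ge0 ?gauss_ge0//.
  exact: q0.
apply: filterS => w /(_ I) []; rewrite mul1r => h0; rewrite leNgt; apply/negP => sw.
by have := gauss_gt0 (x - s / u * beta u w) (bridge_variance_gt0 s0 su sw); rewrite h0 ltxx.
Qed.

Lemma markov_kernel_cvg (g : R -> R) (s_ : nat -> R) (t s1 u : R) :
  measurable_fun setT g -> (forall x, 0 <= g x) ->
  (\int[P]_w (g (beta u w))%:E < +oo)%E ->
  0 < t -> s1 < u -> (forall n, t < s_ n <= s1) -> s_ n @[n --> \oo] --> t ->
  {ae P, forall w, ((kernel g (s_ n) u (beta (s_ n) w))%:E @[n --> \oo] -->
                    (kernel g t u (beta t w))%:E)%E}.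
Proof.
move=> mg g0 ig t0 s1u ts st.
have ts1 : t < s1 by have /andP[h1 h2] := ts 0%N; exact: lt_le_trans h2.
have s10 := lt_trans t0 ts1; have u0 := lt_trans s10 s1u; have tu := lt_trans ts1 s1u.
have s_0 n : 0 < s_ n by have /andP[h _] := ts n; exact: lt_trans h.
have i1 : (\int[P]_w ((cst 1 : R -> R) (beta u w))%:E < +oo)%E.
  by rewrite /= integral_cst//= mul1e probability_setT ltry.
have absorbed w : tau w <= t -> ((kernel g (s_ n) u (beta (s_ n) w))%:E @[n --> \oo] -->
                    (kernel g t u (beta t w))%:E)%E.
  move=> wt; rewrite (information_absorbed W t0 wt).
  rewrite (_ : (fun n => _) = cst (kernel g t u 0)%:E); first exact: cvg_cst.
  apply/funext => n; have /andP[tn _] := ts n.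
  rewrite (information_absorbed W (s_0 n) (le_trans wt (ltW tn))).
  by rewrite /markov_kernel eqxx.
(* Either the limit denominator has a zero and all paths are almost surely absorbed, or it never
   vanishes and the quotient may pass to the limit. *)
have [[x q0]|qn0] := pselect (exists x, density (cst 1) t u x = 0%E).
  by apply: filterS (bridge_density1_eq0 t0 tu q0) => w; exact: absorbed.
apply: filterS (information_zero_ae hW mtau tau0 hind t0) => w hw.
have [b0|b0] := eqVneq (beta t w) 0; first exact/absorbed/hw.
have bcvg : beta (s_ n) w @[n --> \oo] --> beta t w.
  by apply: information_cvg => // [n|]; exact: ltW.
(* By continuity the values [beta (s_ n) w] stay at distance at least [|beta t w| / 2] from 0 after
   some index [N]; shifting by [N] makes this hold for all indices. *)
have e0 : 0 < `|beta t w| / 2 by rewrite divr_gt0// normr_gt0.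
have [N _ hN] : \forall n \near \oo, `|beta t w| / 2 <= `|beta (s_ n) w|.
  have nb : `|beta (s_ n) w| @[n --> \oo] --> `|beta t w| by exact: cvg_norm.
  have h2 : `|beta t w| / 2 < `|beta t w|.
    by rewrite ltr_pdivrMr// ltr_pMr ?normr_gt0// ltr1n.
  by apply: filterS (cvgr_gt _ nb _ h2) => n; exact: ltW.
have shifted (f : R -> R) : measurable_fun setT f -> (forall x, 0 <= f x) ->
    (\int[P]_w (f (beta u w))%:E < +oo)%E ->
    (density f (s_ (n + N)%N) u (beta (s_ (n + N)%N) w) @[n --> \oo] -->
       density f t u (beta t w))%E.
  move=> mf f0 if_; apply: (bridge_density_cvg (e := `|beta t w| / 2)) => //; first exact: s1u.
  - by rewrite (cvg_shiftn N s_).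
  - by move=> n; apply: hN; rewrite /= leq_addl.
  - by rewrite (cvg_shiftn N (fun n => beta (s_ n) w)).
have kcvg := shifted g mg g0 ig.
have qcvg := shifted (cst 1) m1 c10 i1.
have kfin := bridge_density_fin hW mtau t0 tu b0 mg g0 ig.
have qfin := bridge_density1_fin hW mtau t0 tu b0.
rewrite -(cvg_shiftn N (fun n => (kernel g (s_ n) u (beta (s_ n) w))%:E)).
apply: cvg_EFin; first exact: nearW.
have bn0 n : beta (s_ (n + N)%N) w != 0.
  by rewrite -normr_gt0 (lt_le_trans e0)//; apply: hN; rewrite /= leq_addl.
rewrite /markov_kernel (negbTE b0).
rewrite [X in X @ _ --> _](_ : _ = fun n => fine (density g (s_ (n + N)%N) u (beta (s_ (n + N)%N) w)) /
    fine (density (cst 1) (s_ (n + N)%N) u (beta (s_ (n + N)%N) w))); last first.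
  by apply/funext => n /=; rewrite (negbTE (bn0 n)).
apply: cvgM; first by apply: fine_cvg; rewrite fineK.
apply: cvgV; last by apply: fine_cvg; rewrite fineK.
by apply/eqP => q0; apply: qn0; exists (beta t w); rewrite -(fineK qfin) q0.
Qed.

Lemma markov_right_limit (g : R -> R) (t u : R) (A : set T) :
  measurable_fun setT g -> (forall x, 0 <= g x) ->
  (\int[P]_w (g (beta u w))%:E < +oo)%E -> 0 < t -> t < u ->
  (forall v, t < v -> natural_filtration beta v A) ->
  (\int[P]_(w in A) (kernel g t u (beta t w))%:E = \int[P]_(w in A) (g (beta u w))%:E)%E.
Proof.
move=> mg g0 ig t0 tu FA; have u0 := lt_trans t0 tu.
(* These times decrease to [t] and stay below the midpoint of [t] and [u], which keeps the
   domination uniform. *)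
pose s_ n := t + (u - t) / 2 * n.+1%:R^-1.
have ut2 : 0 < (u - t) / 2 by rewrite divr_gt0// subr_gt0.
have s_t : s_ n @[n --> \oo] --> t.
  rewrite -[X in _ --> X]addr0 -[X in _ --> _ + X](mulr0 ((u - t) / 2)).
  by apply: cvgD; [exact: cvg_cst|apply: cvgMr; exact: cvg_harmonic].
have ts n : t < s_ n <= t + (u - t) / 2.
  rewrite ltrDl mulr_gt0 ?invr_gt0//= lerD2l ler_piMr ?(ltW ut2)//.
  by rewrite invf_le1// ler1n.
have s1u : t + (u - t) / 2 < u by lra.
have mkb s : 0 < s -> measurable_fun setT (fun w => (kernel g s u (beta s w))%:E).
  move=> s0; apply/measurable_EFinP.
  exact: (measurableT_comp (measurable_markov_kernel hW mtau s u0 mg g0) (mbeta (ltW s0))).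
have FC v : t < v -> natural_filtration beta v (~` A).
  by move=> tv; apply: (@measurableC _ (g_sigma_algebraType _)); exact: FA.
have s_0 n : 0 < s_ n by have /andP[h _] := ts n; exact: lt_trans h.
have nu n : s_ n < u by have /andP[_ h] := ts n; exact: le_lt_trans s1u.
have tn n : t < s_ n by have /andP[] := ts n.
apply: (fatou_eq (h_ := fun n w => (kernel g (s_ n) u (beta (s_ n) w))%:E)) => //.
- by move=> n; exact: mkb.
- exact: mkb.
- by apply/measurable_EFinP; exact: (measurableT_comp mg (mbeta (ltW u0))).
- by move=> n w; rewrite lee_fin markov_kernel_ge0.
- by move=> w; rewrite lee_fin markov_kernel_ge0.
- by move=> w; rewrite lee_fin.
- exact: (markov_kernel_cvg mg g0 ig t0 s1u ts s_t).
- exact: (natural_filtration_measurable hW mtau (FA _ tu)).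
- move=> n; apply/esym; apply: (markov_fixed_time hW mtau tau0 hind) => //.
  exact: FA.
- move=> n; apply/esym; apply: (markov_fixed_time hW mtau tau0 hind) => //.
  exact: FC.
(* The total masses agree by the fixed-time identity at [t] itself, over the whole space. *)
- apply/esym; apply: (markov_fixed_time hW mtau tau0 hind) => //.
  exact: (@sub_sigma_setT _ T).
Qed.

End markov_right_limit.

(** * Bridge laws near time 0 in total variation *)

Section gauss_ratio.
Context {R : realType}.

Definition bridge_ratio (r c s x : R) : R :=
  Num.sqrt (r / (r - s)) *
  expR ((- x ^+ 2 + 2 * r * x * c - r * s * c ^+ 2) / (2 * (r - s))).

(* The density of a Brownian bridge of length [r], drifted by [c], at time [s]
   with respect to Brownian motion. *)
Lemma gauss_bridge_ratio (r c s x : R) : 0 < s -> s < r ->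
  gauss (s * (r - s) / r) (x - s * c) = bridge_ratio r c s x * gauss s x.
Proof.
move=> s0 sr; have r0 := lt_trans s0 sr; have rs0 : 0 < r - s by rewrite subr_gt0.
have v0 : 0 < s * (r - s) / r by rewrite divr_gt0// mulr_gt0.
rewrite !gaussE// /bridge_ratio mulrACA -expRD; congr (_ * expR _).
  have q0 : 0 < r / (r - s) by rewrite divr_gt0.
  have p0 := pi_gt0 R.
  have sp : 0 < s * pi *+ 2 by rewrite pmulrn_lgt0// mulr_gt0.
  have vp : 0 < s * (r - s) / r * pi *+ 2 by rewrite pmulrn_lgt0// mulr_gt0.
  apply: (mulfI (lt0r_neq0 (_ : 0 < Num.sqrt (s * (r - s) / r * pi *+ 2)))).
    by rewrite sqrtr_gt0.
  rewrite divff; last by rewrite gt_eqF// sqrtr_gt0.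
  rewrite mulrA -sqrtrM ?(ltW vp)//.
  rewrite (_ : _ * (r / (r - s)) = s * pi *+ 2); last first.
    by field; rewrite !gt_eqF.
  by rewrite divff// gt_eqF// sqrtr_gt0.
by field; rewrite !gt_eqF.
Qed.

Lemma bridge_ratio_ge0 (r c s x : R) : 0 <= bridge_ratio r c s x.
Proof. by rewrite mulr_ge0 ?expR_ge0. Qed.

Lemma bridge_ratio_cvg (r c : R) (s_ x_ : nat -> R) : 0 < r ->
  s_ n @[n --> \oo] --> (0 : R) -> x_ n @[n --> \oo] --> (0 : R) ->
  bridge_ratio r c (s_ n) (x_ n) @[n --> \oo] --> (1 : R).
Proof.
move=> r0 s_0 x_0.
have rn : r - s_ n @[n --> \oo] --> r.
  by rewrite -[X in _ --> X]subr0; apply: cvgB => //; exact: cvg_cst.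
rewrite (_ : (1 : R) = Num.sqrt (r * r^-1) *
   expR ((- (0 * 0) + 2 * r * 0 * c - r * 0 * c ^+ 2) * (2 * r)^-1)); last first.
  by rewrite divff ?gt_eqF// sqrtr1 !(mulr0, mul0r) subr0 oppr0 add0r mul0r expR0 mulr1.
apply: cvgM.
  apply: (@cvg_comp _ _ _ (fun n => r / (r - s_ n)) Num.sqrt); last exact: sqrt_continuous.
  by apply: cvgMr; apply: cvgV => //; rewrite gt_eqF.
apply: (@cvg_comp _ _ _ (fun n => (- x_ n ^+ 2 + 2 * r * x_ n * c - r * s_ n * c ^+ 2)
  / (2 * (r - s_ n))) expR); last exact: continuous_expR.
apply: cvgM; last by apply: cvgV; [rewrite gt_eqF// mulr_gt0|exact: cvgMr].
apply: cvgB.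
  apply: cvgD; first by apply: cvgN; exact: (cvgM x_0 x_0).
  by apply: cvgMl; exact: cvgMr.
by apply: cvgMl; exact: cvgMr.
Qed.

End gauss_ratio.

Section gauss_gap.
Context {R : realType} {d} {T : measurableType d} (P : probability T R).
Variables (W : R -> T -> R) (hW : standard_brownian_motion P W).
Local Notation mu := (@lebesgue_measure R).

(** For positive [a] and [s], twice the total variation distance between the normal law of mean [c]
    and variance [a] and the centred one of variance [s]. *)
Definition gauss_gap (a c s : R) : \bar R :=
  (\int[mu]_x (`|gauss a (x - c) - gauss s x|)%:E)%E.

Let mgauss (a c : R) : measurable_fun setT (fun x : R => gauss a (x - c)).
Proof. by apply: measurable_gauss => //; exact: measurable_funB. Qed.

Let mgauss0 (s : R) : measurable_fun setT (gauss s : R -> R).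
Proof. exact: measurable_gauss. Qed.

Let integral_gauss_le1 (a c : R) : (\int[mu]_x (gauss a (x - c))%:E <= 1)%E.
Proof.
have [a0|a0] := ltP 0 a; first by rewrite (integral_gauss _ a0).
by under eq_integral do rewrite gauss_le0//; rewrite integral0.
Qed.

Let integral_gauss0 (s : R) : 0 < s -> (\int[mu]_x (gauss s x)%:E = 1)%E.
Proof.
move=> s0; rewrite -(integral_gauss 0 s0); apply: eq_integral => x _.
by rewrite addr0.
Qed.

(** Serves as domination. No sign condition on [a] is imposed, as [gauss] has mass at most 1 in
    every case. *)
Lemma gauss_gap_le2 (a c s : R) : 0 < s -> (gauss_gap a c s <= 2%:E)%E.
Proof.
move=> s0; have -> : (2%:E = 1 + 1 :> \bar R)%E by rewrite -EFinD.
apply: (@le_trans _ _ (\int[mu]_x ((gauss a (x - c))%:E + (gauss s x)%:E))%E).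
  have m1 : measurable_fun setT (fun x : R => (`|gauss a (x - c) - gauss s x|)%:E).
    by apply/measurable_EFinP; apply: measurableT_comp => //; exact: measurable_funB.
  have m2 : measurable_fun setT (fun x : R => ((gauss a (x - c))%:E + (gauss s x)%:E)%E).
    by apply: emeasurable_funD; apply/measurable_EFinP.
  apply: ge0_le_integral => //.
  move=> x _; rewrite -EFinD lee_fin.
  by rewrite (le_trans (ler_normB _ _))// !ger0_norm ?gauss_ge0.
rewrite ge0_integralD//.
- by rewrite leeD// integral_gauss0.
- by move=> x _; rewrite lee_fin gauss_ge0.
- by apply/measurable_EFinP; exact: mgauss.
- by move=> x _; rewrite lee_fin gauss_ge0.
- by apply/measurable_EFinP; exact: mgauss0.
Qed.

(** The part by which the likelihood ratio falls short of 1. It lies between 0 and 1, whatever the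
    size of the ratio. *)
Let deficit (r c s x : R) : R := Num.max 0 (1 - bridge_ratio r c s x).

Let deficit0 r c s x : 0 <= deficit r c s x.
Proof. by rewrite le_max lexx. Qed.

Let deficit1 r c s x : deficit r c s x <= 1.
Proof. by rewrite ge_max ler01 lerBlDr lerDl bridge_ratio_ge0. Qed.

Let mdeficit r c s : measurable_fun setT (deficit r c s).
Proof.
apply: measurable_maxr => //; apply: measurable_funB => //.
apply: measurable_funM => //; apply: measurableT_comp => //.
apply: measurable_funM => //; apply: measurable_funB => //.
apply: measurable_funD.
  by apply: measurableT_comp => //; exact: measurable_funX.
by do 2 apply: measurable_funM => //.
Qed.

(* Both densities have mass 1, and [|f - p| = f - p + 2 max (0, p - f)]. *)
Lemma gauss_gapE (r c s : R) : 0 < s -> s < r ->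
  gauss_gap (s * (r - s) / r) (s * c) s =
  (2%:E * \int[P]_w (Num.max 0 (1 - bridge_ratio r c s (W s w)))%:E)%E.
Proof.
move=> s0 sr; have r0 := lt_trans s0 sr.
have a0 : 0 < s * (r - s) / r by rewrite divr_gt0// mulr_gt0// subr_gt0.
set a := s * (r - s) / r in a0 *.
rewrite (gaussian_integral (h := fun x => (deficit r c s x)%:E)
  (bm_measurable hW (ltW s0)) (gaussian_BM hW s0)); first last.
- by move=> x; rewrite lee_fin.
- by apply/measurable_EFinP; exact: mdeficit.
have m1 : measurable_fun setT (fun x : R => (`|gauss a (x - s * c) - gauss s x|)%:E).
  by apply/measurable_EFinP; apply: measurableT_comp => //; exact: measurable_funB.
have m2 : measurable_fun setT (fun x : R => (gauss s x)%:E).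
  by apply/measurable_EFinP; exact: mgauss0.
have m3 : measurable_fun setT (fun x : R => (gauss a (x - s * c))%:E).
  by apply/measurable_EFinP; exact: mgauss.
have m4 : measurable_fun setT (fun x : R => ((deficit r c s x)%:E * (gauss s x)%:E)%E).
  by apply: emeasurable_funM => //; apply/measurable_EFinP; exact: mdeficit.
have p1 (x : R) : (0 <= (`|gauss a (x - s * c) - gauss s x|)%:E)%E by rewrite lee_fin.
have p2 (x : R) : (0 <= (gauss s x)%:E)%E by rewrite lee_fin gauss_ge0.
have p3 (x : R) : (0 <= (gauss a (x - s * c))%:E)%E by rewrite lee_fin gauss_ge0.
have p4 (x : R) : (0 <= (deficit r c s x)%:E * (gauss s x)%:E)%E by rewrite mule_ge0// lee_fin.
have m5 : measurable_fun setT (fun x : R => (2%:E * ((deficit r c s x)%:E * (gauss s x)%:E))%E).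
  exact: measurable_funeM.
have p5 (x : R) : (0 <= 2%:E * ((deficit r c s x)%:E * (gauss s x)%:E))%E by rewrite mule_ge0.
(* The 1 on each side stands for the mass of a different density, so that only nonnegative functions
   are integrated. *)
have E : (gauss_gap a (s * c) s + 1 =
    2%:E * \int[mu]_x ((deficit r c s x)%:E * (gauss s x)%:E) + 1)%E.
  rewrite -[X in (_ + X = _)%E](integral_gauss0 s0) -[X in (_ = _ + X)%E](integral_gauss (- (s * c)) a0).
  transitivity (\int[mu]_x ((`|gauss a (x - s * c) - gauss s x|)%:E + (gauss s x)%:E))%E.
    by apply/esym; apply: ge0_integralD.
  transitivity (\int[mu]_x (2%:E * ((deficit r c s x)%:E * (gauss s x)%:E) + (gauss a (x - s * c))%:E))%E; last first.
    transitivity ((\int[mu]_x (2%:E * ((deficit r c s x)%:E * (gauss s x)%:E))) +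
       \int[mu]_x (gauss a (x - s * c))%:E)%E; first exact: ge0_integralD.
    congr (_ + _)%E; exact: ge0_integralZl.
  apply: eq_integral => x _; rewrite -(EFinM (deficit r c s x)) -EFinM -!EFinD; congr EFin.
  have dE : deficit r c s x * gauss s x = Num.max 0 (gauss s x - gauss a (x - s * c)).
    rewrite /deficit gauss_bridge_ratio// maxr_pMl ?gauss_ge0// mul0r.
    by rewrite mulrBl mul1r.
  rewrite dE; have [h|h] := leP 0 (gauss s x - gauss a (x - s * c)).
    by rewrite distrC ger0_norm//; ring.
  by rewrite distrC ltr0_norm//; ring.
by rewrite -[LHS](@addeK _ 1%E)// E addeK.
Qed.

(** Scheffe's argument. Realising the centred normal law as that of [W s] makes the convergence
    pathwise: [W (s_ n)] tends to [W 0 = 0], the ratio to 1, and the deficit is bounded by 1. *)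
Lemma gauss_gap_cvg (r c : R) (s_ : nat -> R) : 0 < r ->
  (forall n, 0 < s_ n) -> s_ n @[n --> \oo] --> (0 : R) ->
  (gauss_gap (s_ n * (r - s_ n) / r) (s_ n * c) (s_ n) @[n --> \oo] --> 0)%E.
Proof.
move=> r0 s0 s_0.
have [N _ hN] : \forall n \near \oo, s_ n < r by exact: cvgr_lt s_0 _ r0.
have sr n : s_ (n + N)%N < r by apply: hN; rewrite /= leq_addl.
rewrite -(cvg_shiftn N (fun n => gauss_gap (s_ n * (r - s_ n) / r) (s_ n * c) (s_ n))).
under eq_fun do rewrite gauss_gapE//.
have := @dominated_convergence _ _ _ P setT measurableT
  (fun n w => (deficit r c (s_ (n + N)%N) (W (s_ (n + N)%N) w))%:E)
  (cst 0%E) (cst 1%E).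
case=> //.
- move=> n; apply/measurable_EFinP.
  exact: (measurableT_comp (mdeficit _ _ _) (bm_measurable hW (ltW (s0 _)))).
- apply: aeW => w _; apply: cvg_EFin; first exact: nearW.
  have sN : s_ (n + N)%N @[n --> \oo] --> (0 : R) by rewrite (cvg_shiftn N s_).
  have WN : W (s_ (n + N)%N) w @[n --> \oo] --> (0 : R).
    rewrite -(bm_start hW w); apply: (BM_cvg hW) => // n; exact: ltW.
  rewrite [X in _ --> X](_ : _ = Num.max 0 (1 - 1) :> R); last by rewrite subrr maxxx.
  rewrite maxC (_ : _ \o _ = fun n => Num.max
      (1 - bridge_ratio r c (s_ (n + N)%N) (W (s_ (n + N)%N) w)) 0); last first.
    by apply/funext => n /=; rewrite maxC.
  apply: cvg_maxr_cst; apply: cvgB; first exact: cvg_cst.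
  exact: bridge_ratio_cvg.
- apply/integrableP; split => //.
  by under eq_integral do rewrite /= normr1; rewrite integral_cst//= mul1e probability_setT ltry.
- by apply: aeW => w n _; rewrite gee0_abs ?lee_fin.
move=> _ _; rewrite integral0 => /(cvgeZl (isT : (2%:E : \bar R) \is a fin_num)).
by rewrite mule0.
Qed.

End gauss_gap.

(** * Independence of the germ events at time 0 *)

Section markov_at_zero.
Context {R : realType} {d} {T : measurableType d} (P : probability T R).
Variables (W : R -> T -> R) (hW : standard_brownian_motion P W).
Variables (tau : T -> R) (mtau : measurable_fun setT tau) (tau0 : forall w, 0 < tau w).
Hypothesis hind : independent_systems P (g_sigma_algebra_preimage tau)
  (sigma_process `[0, +oo[ W).
Local Notation mu := (@lebesgue_measure R).
Local Notation beta := (information_process W tau).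
Local Notation density := (bridge_density P W tau).
Local Notation kernel := (markov_kernel P W tau).

Variables (u : R) (g : R -> R).
Hypotheses (u0 : 0 < u) (mg : measurable_fun setT g) (g0 : forall x, 0 <= g x).
Hypothesis ig : (\int[P]_w (g (beta u w))%:E < +oo)%E.

Let mbeta s : (0 <= s)%R -> measurable_fun setT (beta s).
Proof. by move=> s0; exact: (measurable_information hW). Qed.

Let m1 : measurable_fun setT (cst 1%R : R -> R). Proof. exact: measurable_cst. Qed.
Let c10 x : (0 <= (cst 1%R : R -> R) x)%R. Proof. exact: ler01. Qed.

Let G w := g (beta u w).
Let mG : measurable_fun setT G.
Proof. exact: (measurableT_comp mg (mbeta (ltW u0))). Qed.

Let G0 w : 0 <= G w. Proof. exact: g0. Qed.

Let m := fine (\int[P]_w (G w)%:E).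
Let mE : (\int[P]_w (G w)%:E = m%:E)%E.
Proof.
by rewrite fineK// ge0_fin_numE// integral_ge0// => w _; rewrite lee_fin.
Qed.

Let m0 : 0 <= m.
Proof. by rewrite -lee_fin -mE; apply: integral_ge0 => w _; rewrite lee_fin. Qed.

Let gam s x w := gauss (bridge_variance s u (tau w)) (x - s / u * beta u w).
Let gam0 s x w : 0 <= gam s x w. Proof. exact: gauss_ge0. Qed.

Let mgam2 s : measurable_fun setT (fun z : R * T => gam s z.1 z.2).
Proof.
have mbu2 := measurableT_comp (mbeta (ltW u0)) (@measurable_snd _ _ R T).
apply: measurable_gauss.
  apply: (measurableT_comp (measurable_bridge_variance s u)).
  exact: (measurableT_comp mtau measurable_snd).
by apply: measurable_funB; [exact: measurable_fst|exact: measurable_funM].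
Qed.

Let mgamw s x : measurable_fun setT (gam s x).
Proof. exact: (measurableT_comp (mgam2 s) (measurable_pair1 x)). Qed.

Let mgamx s w : measurable_fun setT (fun x : R => gam s x w).
Proof. exact: (measurableT_comp (mgam2 s) (measurable_pair2 w)). Qed.

Let mgs s : measurable_fun setT (gauss s : R -> R).
Proof. by apply: measurable_gauss. Qed.

Let gap s x w := `|m - G w| * `|gam s x w - gauss s x|.

Let gap0 s x w : 0 <= gap s x w. Proof. by rewrite mulr_ge0. Qed.

Let mgap2 s : measurable_fun setT (fun z : R * T => gap s z.1 z.2).
Proof.
apply: measurable_funM.
  apply: measurableT_comp => //; apply: measurable_funB => //.
  exact: (measurableT_comp mG measurable_snd).
apply: measurableT_comp => //; apply: measurable_funB => //.
exact: (measurableT_comp (mgs s) measurable_fst).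
Qed.

Let mgapw s x : measurable_fun setT (gap s x).
Proof. exact: (measurableT_comp (mgap2 s) (measurable_pair1 x)). Qed.

(* Integrating [(m - g) (gam - p) <= |m - g| |gam - p|], where [g] has mean [m]. *)
Let density_lower_bound s x : 0 < s -> s < u -> x != 0 ->
  (m%:E * density (cst 1%R) s u x <= density g s u x + \int[P]_w (gap s x w)%:E)%E.
Proof.
move=> s0 su x0; set p := gauss s x.
have p0 : 0 <= p by exact: gauss_ge0.
have mE1 (f : T -> R) : measurable_fun setT f -> measurable_fun setT (EFin \o f).
  by move=> mf; exact/measurable_EFinP.
have mp_fin : (m * p)%:E \is a fin_num by [].
(* Adding [m * p] removes all subtractions: it is the mean of [G * p] on the left, and of a constant
   on the right. *)
rewrite -(leeD2rE _ _ mp_fin).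
have -> : (m%:E * density (cst 1%R) s u x + (m * p)%:E =
    \int[P]_w (m * gam s x w + G w * p)%:E)%E.
  rewrite (_ : (m * p)%:E = \int[P]_w (G w * p)%:E)%E; last first.
    under eq_integral do rewrite EFinM.
    rewrite ge0_integralZr//; [by rewrite mE -EFinM|exact: mE1|].
    by move=> w _; rewrite lee_fin.
  rewrite /bridge_density -ge0_integralZl//; first last.
  - by move=> w _; rewrite lee_fin mulr_ge0 ?gauss_ge0.
  - exact: (measurable_weighted_gauss1 hW mtau m1).
  rewrite -ge0_integralD//.
  - by apply: eq_integral => w _; rewrite -EFinM -EFinD mul1r.
  - by move=> w _; rewrite -EFinM lee_fin !mulr_ge0 ?gauss_ge0.
  - by apply: measurable_funeM; exact: (measurable_weighted_gauss1 hW mtau m1).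
  - by move=> w _; rewrite lee_fin mulr_ge0.
  - by apply: mE1; exact: measurable_funM.
have -> : (density g s u x + \int[P]_w (gap s x w)%:E + (m * p)%:E =
    \int[P]_w (G w * gam s x w + gap s x w + m * p)%:E)%E.
  rewrite (_ : (m * p)%:E = \int[P]_w (cst (m * p)%:E) w)%E; last first.
    by rewrite integral_cst//= probability_setT mule1.
  rewrite /bridge_density -ge0_integralD//; last 4 first.
  - by move=> w _; rewrite lee_fin mulr_ge0 ?gauss_ge0.
  - exact: (measurable_weighted_gauss1 hW mtau mg).
  - by move=> w _; rewrite lee_fin.
  - exact: mE1.
  rewrite -ge0_integralD//.
  - by move=> w _; rewrite -EFinD lee_fin addr_ge0// mulr_ge0 ?gauss_ge0.
  - apply: emeasurable_funD; last exact: mE1.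
    exact: (measurable_weighted_gauss1 hW mtau mg).
  - by move=> w _; rewrite lee_fin mulr_ge0.
apply: ge0_le_integral => //.
- by move=> w _; rewrite lee_fin addr_ge0 ?mulr_ge0.
- by apply: mE1; apply: measurable_funD; apply: measurable_funM.
- by apply: mE1; apply: measurable_funD => //; apply: measurable_funD => //; apply: measurable_funM.
- move=> w _; rewrite lee_fin /gap.
  have := ler_norm ((m - G w) * (gam s x w - p)); rewrite normrM -/p.
  by rewrite mulrBl !mulrBr; lra.
Qed.

(** How far the kernel falls below the mean [m]. It is 0 at [x = 0], since that case is charged to
    the event [tau <= s]. *)
Let psi s x : R := if x == 0 then 0 else Num.max 0 (m - kernel g s u x).

Let psi0 s x : 0 <= psi s x.
Proof. by rewrite /psi; case: ifP => // _; rewrite le_max lexx. Qed.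

Let mpsi s : measurable_fun setT (psi s).
Proof.
apply: measurable_fun_ifT => //; first exact: measurable_fun_eqr.
apply: measurable_maxr => //; apply: measurable_funB => //.
exact: (measurable_markov_kernel hW mtau).
Qed.

Let psi_density s x : 0 < s -> s < u ->
  ((psi s x)%:E * density (cst 1%R) s u x <= \int[P]_w (gap s x w)%:E)%E.
Proof.
move=> s0 su; have gap_ge0 : (0 <= \int[P]_w (gap s x w)%:E)%E.
  by apply: integral_ge0 => w _; rewrite lee_fin.
rewrite /psi; have [x0|x0] := eqVneq x 0; first by rewrite mul0e.
have [km|mk] := leP 0 (m - kernel g s u x); last by rewrite mul0e.
have kfin := bridge_density_fin hW mtau s0 su x0 mg g0 ig.
have qfin := bridge_density1_fin hW mtau s0 su x0.
rewrite -(leeD2rE _ _ kfin) [leRHS]addeC.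
apply: le_trans (density_lower_bound s0 su x0).
rewrite -(markov_kernelE hW mtau s0 su x0 mg g0 ig) -muleDl//.
- by rewrite -EFinD subrK.
Qed.

(** The error term does not depend on [A] and tends to 0 with [s], so the estimate survives for
    events known at all positive times. *)
Let lower_bound s A : 0 < s -> s < u -> natural_filtration beta s A ->
  (m%:E * P A <= \int[P]_(w in A) (G w)%:E +
     \int[P]_w (\int[mu]_x (gap s x w)%:E + (m * (tau w <= s)%R%:R)%:E))%E.
Proof.
move=> s0 su FA; have mA := natural_filtration_measurable hW mtau FA.
have mind : measurable_fun setT (fun w => (tau w <= s)%R%:R : R).
  rewrite (_ : (fun w => _) = (fun r : R => \1_(`]-oo, s]%classic) r) \o tau).
    exact: (measurableT_comp (measurable_indic (measurable_itv _)) mtau).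
  by apply/funext => w /=; rewrite indicE mem_setE in_itv.
have mbs := mbeta (ltW s0).
have mk : measurable_fun setT (fun w => (kernel g s u (beta s w))%:E).
  by apply/measurable_EFinP; apply: (measurableT_comp _ mbs); exact: (measurable_markov_kernel hW mtau).
have mp : measurable_fun setT (fun w => (psi s (beta s w))%:E).
  by apply/measurable_EFinP; exact: (measurableT_comp (mpsi s) mbs).
have mi : measurable_fun setT (fun w => (m * (tau w <= s)%R%:R)%:E).
  by apply/measurable_EFinP; exact: measurable_funM.
have k0 w : (0 <= (kernel g s u (beta s w))%:E)%E by rewrite lee_fin markov_kernel_ge0.
have p0 w : (0 <= (psi s (beta s w))%:E)%E by rewrite lee_fin.
have i0 w : (0 <= (m * (tau w <= s)%R%:R)%:E)%E by rewrite lee_fin mulr_ge0.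
have S0 w : (0 <= \int[mu]_x (gap s x w)%:E)%E.
  by apply: integral_ge0 => x _; rewrite lee_fin.
have mgapE : measurable_fun setT (fun z : R * T => (gap s z.1 z.2)%:E).
  exact/measurable_EFinP.
have gapE0 (z : R * T) : (0 <= (gap s z.1 z.2)%:E)%E by rewrite lee_fin.
have mS : measurable_fun setT (fun w => \int[mu]_x (gap s x w)%:E)%E.
  exact: (measurable_fun_fubini_tonelli_G (m1 := mu) _ mgapE gapE0).
have -> : (m%:E * P A = \int[P]_(w in A) cst m%:E w)%E by rewrite integral_cst.
(* Off 0, [psi] makes up the deficit of the kernel; at 0, almost surely [tau <= s] and the indicator
   term supplies [m]. *)
apply: (@le_trans _ _ (\int[P]_(w in A) ((kernel g s u (beta s w))%:E +
    ((psi s (beta s w))%:E + (m * (tau w <= s)%R%:R)%:E)))%E).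
  apply: ae_ge0_le_integral => //.
  - by move=> w _; rewrite !adde_ge0.
  - by apply: measurable_funTS; apply: emeasurable_funD => //; exact: emeasurable_funD.
  - apply: filterS (information_zero_ae hW mtau tau0 hind s0) => w hw _.
    rewrite /= -!EFinD lee_fin /psi.
    have [b0|b0] := eqVneq (beta s w) 0.
      by rewrite (hw b0) mulr1 add0r lerDr markov_kernel_ge0.
    rewrite addrA -[leLHS]addr0; apply: lerD; last by rewrite mulr_ge0.
    by rewrite -lerBlDl le_max lexx orbT.
rewrite ge0_integralD//; try exact: measurable_funTS; last 2 first.
- by move=> w _; rewrite adde_ge0.
- by apply: measurable_funTS; exact: emeasurable_funD.
rewrite -(markov_fixed_time hW mtau tau0 hind s0 su mg g0 ig FA).
apply: leeD2l.
apply: (@le_trans _ _ (\int[P]_w ((psi s (beta s w))%:E + (m * (tau w <= s)%R%:R)%:E))%E).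
  by apply: ge0_subset_integral => //; [exact: emeasurable_funD|move=> w _; rewrite adde_ge0].
rewrite ge0_integralD// [leRHS]ge0_integralD//; apply: leeD2r.
have := information_density_integral hW mtau tau0 hind s0 su
  (@sub_sigma_setT _ T _ : bridge_algebra W s setT) m1 (mpsi s) c10 (psi0 s).
rewrite probability_setT mul1e => K.
have -> : (\int[P]_w (psi s (beta s w))%:E = \int[mu]_x ((psi s x)%:E * density (cst 1%R) s u x))%E.
  rewrite -K; apply: eq_integral => w _; rewrite indicT mul1e mul1r.
  congr EFin; rewrite /psi; have [b0|b0] := eqVneq (beta s w) 0; first by rewrite mulr0.
  by rewrite (information_nonzero s0 b0) mul1r.
rewrite -(fubini_tonelli (m1 := mu) (m2 := P) _ mgapE gapE0).
have mpq : measurable_fun setT (fun x : R => ((psi s x)%:E * density (cst 1%R) s u x)%E).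
  apply: emeasurable_funM; first by apply/measurable_EFinP; exact: mpsi.
  exact: (measurable_bridge_density hW mtau m1 c10).
apply: ge0_le_integral => //.
- by move=> x _; rewrite mule_ge0 ?lee_fin// bridge_density_ge0.
- exact: (measurable_fun_fubini_tonelli_F (m2 := P) _ mgapE gapE0).
- by move=> x _; exact: psi_density.
Qed.

Let rem s w := (\int[mu]_x (gap s x w)%:E + (m * (tau w <= s)%R%:R)%:E)%E.

Let rem_gauss_gap s w : rem s w = (`|m - G w|%:E *
  gauss_gap (bridge_variance s u (tau w)) (s / u * beta u w) s + (m * (tau w <= s)%R%:R)%:E)%E.
Proof.
congr (_ + _)%E.
transitivity (\int[mu]_x (`|m - G w|%:E * (`|gam s x w - gauss s x|)%:E))%E; first by [].
apply: ge0_integralZl => //.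
apply/measurable_EFinP; apply: measurableT_comp => //.
by apply: measurable_funB; [exact: mgamx|exact: mgs].
Qed.

Let rem0 s w : (0 <= rem s w)%E.
Proof. by rewrite adde_ge0 ?lee_fin ?mulr_ge0//; apply: integral_ge0 => x _; rewrite lee_fin. Qed.

Let mrem s : measurable_fun setT (rem s).
Proof.
have mgapE : measurable_fun setT (fun z : R * T => (gap s z.1 z.2)%:E).
  exact/measurable_EFinP.
have gapE0 (z : R * T) : (0 <= (gap s z.1 z.2)%:E)%E by rewrite lee_fin.
apply: emeasurable_funD; first exact: (measurable_fun_fubini_tonelli_G (m1 := mu) _ mgapE gapE0).
apply/measurable_EFinP; apply: measurable_funM => //.
rewrite (_ : (fun w => _) = (fun r : R => \1_(`]-oo, s]%classic) r) \o tau).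
  exact: (measurableT_comp (measurable_indic (measurable_itv _)) mtau).
by apply/funext => w /=; rewrite indicE mem_setE in_itv.
Qed.

Let time n : R := u / 2 * n.+1%:R^-1.

Let u20 : 0 < u / 2. Proof. by rewrite divr_gt0. Qed.

Let time0 n : 0 < time n. Proof. by rewrite mulr_gt0. Qed.

Let timeu n : time n < u.
Proof.
apply: (@le_lt_trans _ _ (u / 2)); last by rewrite ltr_pdivrMr// ltr_pMr// ltr1n.
by rewrite ler_piMr ?(ltW u20)// invf_le1// ler1n.
Qed.

Let time_cvg : time n @[n --> \oo] --> (0 : R).
Proof. by rewrite -[X in _ --> X](mulr0 (u / 2)); apply: cvgMr; exact: cvg_harmonic. Qed.

(** With [w] fixed this concerns a bridge of length [min u (tau w)] with drift [beta u w / u]; the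
    indicator vanishes eventually because [tau w] is positive. *)
Let rem_cvg_ptw w : (rem (time n) w @[n --> \oo] --> 0)%E.
Proof.
under eq_fun do rewrite rem_gauss_gap.
have r0 : 0 < Num.min u (tau w) by rewrite lt_min u0 tau0.
have := gauss_gap_cvg hW (beta u w / u) r0 time0 time_cvg.
rewrite (_ : (fun n => gauss_gap _ _ _) = fun n => gauss_gap
    (bridge_variance (time n) u (tau w)) (time n / u * beta u w) (time n)); last first.
  apply/funext => n; have -> : time n / u * beta u w = time n * (beta u w / u).
    by rewrite mulrAC mulrA.
  by rewrite /bridge_variance.
move/(cvgeZl (isT : (`|m - G w|%:E \is a fin_num))); rewrite mule0 => c1.
have c2 : ((m * (tau w <= time n)%R%:R)%:E @[n --> \oo] --> 0)%E.
  apply: cvg_near_cst; apply: filterS (cvgr_lt _ time_cvg _ (tau0 w)) => n tn.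
  by rewrite leNgt tn mulr0.
by have := cvgeD (isT : (0%R : \bar R) +? 0%R)%E c1 c2; rewrite adde0; exact.
Qed.

Let iGm : P.-integrable setT (fun w => `|m - G w|%:E).
Proof.
have iG : P.-integrable setT (EFin \o G).
  apply/integrableP; split; first exact/measurable_EFinP.
  by under eq_integral do rewrite gee0_abs ?lee_fin//.
have im := finite_measure_integrable_cst P m measurableT.
exact: (integrable_abse (integrableB measurableT im iG)).
Qed.

Let rem_cvg : (\int[P]_w rem (time n) w @[n --> \oo] --> 0)%E.
Proof.
have := @dominated_convergence _ _ _ P setT measurableT (fun n => rem (time n)) (cst 0%E)
  (fun w => (2%:E * `|m - G w|%:E + m%:E)%E).
case=> //.
- by apply: aeW => w _; exact: rem_cvg_ptw.
- apply: integrableD => //; first exact: integrableZl.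
  exact: (finite_measure_integrable_cst P m measurableT).
- apply: aeW => w n _; rewrite gee0_abs// rem_gauss_gap; apply: leeD.
    by rewrite muleC; apply: lee_wpmul2r => //; rewrite gauss_gap_le2.
  by rewrite lee_fin ler_piMr// lern1 leq_b1.
by move=> _ _; rewrite integral0.
Qed.

(** The limit of the lower bound applies to [A] and to its complement. The two bounds add up to [m],
    which is also the total integral, so neither can be strict. *)
Lemma markov_at_zero A : (forall v, 0 < v -> natural_filtration beta v A) ->
  (\int[P]_(w in A) (g (beta u w))%:E = (fine (\int[P]_w (g (beta u w))%:E))%:E * P A)%E.
Proof.
move=> FA.
have le_int B : (forall v, 0 < v -> natural_filtration beta v B) ->
    (m%:E * P B <= \int[P]_(w in B) (G w)%:E)%E.
  move=> FB.
  have c : (\int[P]_(w in B) (G w)%:E + \int[P]_w rem (time n) w @[n --> \oo] -->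
      \int[P]_(w in B) (G w)%:E)%E.
    rewrite -[X in _ --> X]adde0; apply: cvgeD; last exact: rem_cvg.
      exact: fin_num_adde_defl.
    exact: cvg_cst.
  by apply: (cvge_ge _ c); apply: nearW => n; apply: lower_bound => //; exact: FB.
have mA := natural_filtration_measurable hW mtau (FA _ ltr01).
have FC v : 0 < v -> natural_filtration beta v (~` A).
  by move=> v0; apply: (@measurableC _ (g_sigma_algebraType _)); exact: FA.
have mGE : measurable_fun setT (EFin \o G) by exact/measurable_EFinP.
have GE0 w : (0 <= (G w)%:E)%E by rewrite lee_fin.
have sG : (m%:E = \int[P]_(w in A) (G w)%:E + \int[P]_(w in ~` A) (G w)%:E)%E.
  rewrite -mE -ge0_integral_setU//.
  - by rewrite setUv.
  - exact: measurableC.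
  - by rewrite setUv.
  - by rewrite disj_set2E setICr.
have sm : (m%:E = m%:E * P A + m%:E * P (~` A))%E.
  rewrite probability_setC// -muleDr//; first by rewrite addeC subeK ?fin_num_measure// mule1.
  by rewrite fin_num_adde_defr// fin_num_measure.
suff : (\int[P]_(w in A) (G w)%:E = m%:E * P A)%E by [].
apply/eqP; rewrite eq_le (le_int _ FA) andbT.
have cfin : (m%:E * P (~` A))%E \is a fin_num.
  by rewrite fin_numM// fin_num_measure//; exact: measurableC.
rewrite -(leeD2rE _ _ cfin) -sm; apply: (le_trans (leeD2l _ (le_int _ FC))).
by rewrite -sG.
Qed.

End markov_at_zero.

(** * Uniqueness of conditional expectations and completion *)

Section condexp_uniqueness.
Context {R : realType} {d} {T : measurableType d} (P : probability T R).

(** The event [Y' < Y] belongs to [G], so the positive difference has integral 0 over it, and the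
    event is null. *)
Lemma is_condexp_le (G : set (set T)) (X Y Y' : T -> R) :
  sigma_algebra setT G -> G `<=` measurable ->
  is_condexp P G X Y -> is_condexp P G X Y' -> {ae P, forall w, Y w <= Y' w}.
Proof.
move=> sG Gm [GY iY YX] [GY' iY' Y'X].
have GE : <<s G >> = G by exact: sigma_algebra_id.
have mG (Z : T -> R) : g_sigma_algebra_preimage Z `<=` G ->
    measurable_fun setT (Z : g_sigma_algebraType G -> R).
  by move=> GZ; apply/measurable_g_sigmaP; rewrite GE.
pose D := (fun w => Y w - Y' w) @^-1` `]0, +oo[%classic.
have GD : G D.
  rewrite -GE -[D]setTI.
  exact: (measurable_funB (mG _ GY) (mG _ GY')) (measurable_itv _).
have mD := Gm _ GD.
have mY := measurable_int P iY; have mY' := measurable_int P iY'.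
have mB : measurable_fun setT (fun w => (Y w - Y' w)%:E).
  by apply/measurable_EFinP; apply: measurable_funB; exact/measurable_EFinP.
have iYD := integrableS measurableT mD (@subsetT _ D) iY.
have iYD' := integrableS measurableT mD (@subsetT _ D) iY'.
have : ae_eq P D (fun w => (Y w - Y' w)%:E) (cst 0%E).
  apply: (ae_eq_integral_abs P mD (measurable_funTS mB)).1.
  transitivity (\int[P]_(w in D) (Y w - Y' w)%:E)%E.
    apply: eq_integral => w; rewrite inE /D /= in_itv/= andbT => h.
    by rewrite /= ger0_norm// ltW.
  under eq_integral do rewrite EFinB.
  rewrite integralB_EFin// YX// Y'X// subee//.
  by rewrite -YX// integrable_fin_num.
apply: filterS => w h; rewrite leNgt; apply/negP => lt.
have Dw : D w by rewrite /D /= in_itv/= andbT subr_gt0.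
by have [/eqP] := h Dw; rewrite subr_eq0 => /eqP e; rewrite e ltxx in lt.
Qed.

Lemma is_condexp_unique (G : set (set T)) (X Y Y' : T -> R) :
  sigma_algebra setT G -> G `<=` measurable ->
  is_condexp P G X Y -> is_condexp P G X Y' -> {ae P, forall w, Y w = Y' w}.
Proof.
move=> sG Gm cY cY'.
apply: filterS2 (is_condexp_le sG Gm cY cY') (is_condexp_le sG Gm cY' cY) => w h h'.
by apply/eqP; rewrite eq_le h.
Qed.

Lemma ae_eq_integral_set (f : T -> \bar R) (A B : set T) :
  measurable A -> measurable B -> measurable_fun setT f ->
  {ae P, forall w, A w <-> B w} ->
  (\int[P]_(w in A) f w = \int[P]_(w in B) f w)%E.
Proof.
move=> mA mB mf AB; rewrite integral_mkcond [RHS]integral_mkcond.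
apply: ae_eq_integral => //.
- by apply/(measurable_restrictT _ mA).1; exact: measurable_funTS.
- by apply/(measurable_restrictT _ mB).1; exact: measurable_funTS.
apply: filterS AB => w AB _; rewrite !patchE.
suff -> : (w \in A) = (w \in B) by [].
by apply/idP/idP; rewrite !inE => /AB.
Qed.

(** The sets almost surely equal to a member of [H] form a sigma-algebra containing [H] and the
    negligible sets. *)
Lemma g_sigma_completion (H : set (set T)) (A : set T) : sigma_algebra setT H ->
  <<s H `|` P.-negligible >> A -> exists2 A', H A' & {ae P, forall w, A w <-> A' w}.
Proof.
move=> [H0 HC HU] hA.
pose K := [set A : set T | exists2 A', H A' & {ae P, forall w, A w <-> A' w}].
suff sK : sigma_algebra setT K.
  apply: (smallest_sub sK _) hA; rewrite subUset; split => [B HB|B nB].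
    by exists B => //; exact: aeW.
  exists set0 => //; apply: negligibleS nB => w /= h.
  by apply: contra_notP h => nBw; split.
split.
- by exists set0 => //; exact: aeW.
- move=> B [B' HB' BB']; exists (setT `\` B'); first exact: HC.
  by apply: filterS BB' => w BB' /=; split => -[_ h]; split => // /BB'.
- move=> F FH.
  have {}FH n : exists A', H A' /\ {ae P, forall w, F n w <-> A' w}.
    by have [A' ? ?] := FH n; exists A'.
  have [F' F'H] := choice FH.
  exists (\bigcup_n F' n); first by apply: HU => n; have [] := F'H n.
  have /ae_foralln : forall n, {ae P, forall w, F n w <-> F' n w} by move=> n; have [] := F'H n.
  by apply: filterS => w h; split => -[n _ /h]; exists n.
Qed.

End condexp_uniqueness.

(** * The conditional expectations given the filtration and given the present *)

Section information_markov.
Context {R : realType} {d} {T : measurableType d} (P : probability T R).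
Variables (W : R -> T -> R) (hW : standard_brownian_motion P W).
Variables (tau : T -> R) (mtau : measurable_fun setT tau) (tau0 : forall w, 0 < tau w).
Hypothesis hind : independent_systems P (g_sigma_algebra_preimage tau)
  (sigma_process `[0, +oo[ W).
Local Notation beta := (information_process W tau).

Variables (t u : R).
Hypotheses (t0 : 0 <= t) (tu : t < u).

Let u0 : 0 <= u. Proof. exact: le_trans (ltW tu). Qed.

Let mbeta s : (0 <= s)%R -> measurable_fun setT (beta s).
Proof. by move=> s0; exact: (measurable_information hW). Qed.

Lemma markov_ge0 (g : R -> R) : measurable_fun setT g -> (forall x, 0 <= g x) ->
  (\int[P]_w (g (beta u w))%:E < +oo)%E ->
  exists phi : R -> R, [/\ measurable_fun setT phi, forall x, 0 <= phi x &
    forall A, (forall v, t < v -> natural_filtration beta v A) ->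
      (\int[P]_(w in A) (phi (beta t w))%:E = \int[P]_(w in A) (g (beta u w))%:E)%E].
Proof.
move=> mg g0 ig; have [tp|tn] := ltP 0 t.
  exists (markov_kernel P W tau g t u); split => [|x|A FA].
  - by apply: (measurable_markov_kernel hW mtau) => //; exact: lt_trans tu.
  - exact: markov_kernel_ge0.
  - exact: (markov_right_limit hW mtau tau0 hind).
(* At time 0 the events of the right limit are independent of [beta u], so the constant mean is a
   version. *)
have tE : t = 0 by apply/eqP; rewrite eq_le tn.
exists (cst (fine (\int[P]_w (g (beta u w))%:E)%E)); split => // [x|A].
  by apply: fine_ge0; apply: integral_ge0 => w _; rewrite lee_fin.
rewrite tE => FA.
have mA := natural_filtration_measurable hW mtau (FA _ ltr01).
rewrite (markov_at_zero hW mtau tau0 hind _ mg g0 ig FA) -?tE//.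
set c := fine _; transitivity (\int[P]_(w in A) cst c%:E w)%E; first by [].
by rewrite integral_cst.
Qed.

Let F v := natural_filtration beta v.

Let F_right := \bigcap_(v in [set v | t < v]) F v.

Let sF_right : sigma_algebra setT F_right.
Proof. by apply: sigma_algebra_bigcap => v _; exact: smallest_sigma_algebra. Qed.

Let F_right_measurable : F_right `<=` measurable.
Proof. by move=> A /(_ _ tu); exact: (natural_filtration_measurable hW mtau). Qed.

Hypothesis hP : measure_is_complete P.

(** Completeness of [P] makes the negligible sets measurable. *)
Lemma usual_filtration_measurable : usual_filtration P F t `<=` measurable.
Proof.
apply: sub_g_sigma_measurable; rewrite subUset; split; first exact: F_right_measurable.
by move=> N; exact: hP.
Qed.

Lemma sub_usual_filtration :
  g_sigma_algebra_preimage (beta t) `<=` usual_filtration P F t.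
Proof.
move=> A hA; apply: sub_sigma_algebra; left => v /= tv.
apply: sub_sigma_algebra; exists t => //=.
by rewrite in_itv/= t0 ltW.
Qed.

(** One version serves every [G] in between: it is a function of [beta t], hence measurable for the
    smallest choice, and it satisfies the integral identity on the largest. *)
Lemma markov_condexp (g : R -> R) : measurable_fun setT g ->
  P.-integrable setT (EFin \o (g \o beta u)) ->
  exists Y : T -> R, forall G : set (set T),
    g_sigma_algebra_preimage (beta t) `<=` G -> G `<=` usual_filtration P F t ->
    is_condexp P G (g \o beta u) Y.
Proof.
move=> mg ig.
pose gp x := Num.max (g x) 0; pose gn x := Num.max (- g x) 0.
have gp0 x : 0 <= gp x by rewrite le_max lexx orbT.
have gn0 x : 0 <= gn x by rewrite le_max lexx orbT.
have mgp : measurable_fun setT gp by exact: measurable_maxr.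
have mgn : measurable_fun setT gn.
  by apply: measurable_maxr => //; exact: measurableT_comp.
have part_integrable (h : R -> R) : measurable_fun setT h -> (forall x, 0 <= h x) ->
    (forall x, h x <= `|g x|) -> P.-integrable setT (fun w => (h (beta u w))%:E).
  move=> mh h0 hg; apply: le_integrable ig => //.
    by apply/measurable_EFinP; exact: (measurableT_comp mh (mbeta u0)).
  by move=> w _; rewrite /= lee_fin ger0_norm.
have igp : P.-integrable setT (fun w => (gp (beta u w))%:E).
  by apply: part_integrable => // x; rewrite ge_max ler_norm normr_ge0.
have ign : P.-integrable setT (fun w => (gn (beta u w))%:E).
  by apply: part_integrable => // x; rewrite ge_max -normrN ler_norm normr_ge0.
have lty (h : R -> R) : (forall x, 0 <= h x) -> P.-integrable setT (fun w => (h (beta u w))%:E) ->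
    (\int[P]_w (h (beta u w))%:E < +oo)%E.
  by move=> h0 /integrableP[_]; under eq_integral do rewrite gee0_abs ?lee_fin//.
have [phip [mp p0 hp]] := markov_ge0 mgp gp0 (lty _ gp0 igp).
have [phin [mn n0 hn]] := markov_ge0 mgn gn0 (lty _ gn0 ign).
have phi_integrable (phi h : R -> R) : measurable_fun setT phi -> (forall x, 0 <= phi x) ->
    (forall x, 0 <= h x) -> P.-integrable setT (fun w => (h (beta u w))%:E) ->
    (forall A, (forall v, t < v -> natural_filtration beta v A) ->
      (\int[P]_(w in A) (phi (beta t w))%:E = \int[P]_(w in A) (h (beta u w))%:E)%E) ->
    P.-integrable setT (fun w => (phi (beta t w))%:E).
  move=> mphi phi0 h0 ih hphi; apply/integrableP; split.
    by apply/measurable_EFinP; exact: (measurableT_comp mphi (mbeta t0)).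
  under eq_integral do rewrite gee0_abs ?lee_fin//.
  rewrite hphi; first exact: lty.
  by move=> v _; exact: (@sub_sigma_setT _ T).
have ip := phi_integrable _ _ mp p0 gp0 igp hp.
have in_ := phi_integrable _ _ mn n0 gn0 ign hn.
exists (fun w => phip (beta t w) - phin (beta t w)) => G betaG GF; split.
- move=> _ [B mB <-]; apply: betaG.
  exists ((fun x => phip x - phin x) @^-1` B) => //.
  by rewrite -[X in measurable X]setTI; exact: measurable_funB.
- exact: (integrableB measurableT ip in_).
- move=> A /GF FA; have mA := usual_filtration_measurable FA.
  (* Up to a negligible set [A] belongs to the intersection of the later histories, where the
     identities for [gp] and [gn] hold. *)
  have [A' HA' AA'] := g_sigma_completion sF_right FA.
  have mA' := F_right_measurable HA'.
  have toA' (k : T -> \bar R) : P.-integrable setT k ->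
      (\int[P]_(w in A) k w = \int[P]_(w in A') k w)%E.
    by move=> ik; apply: ae_eq_integral_set => //; exact: (measurable_int P ik).
  have iA' (k : T -> \bar R) : P.-integrable setT k -> P.-integrable A' k.
    by move=> ik; exact: (integrableS measurableT mA' (@subsetT _ A') ik).
  rewrite (toA' _ (integrableB measurableT ip in_)) (toA' _ ig).
  transitivity (\int[P]_(w in A') (phip (beta t w))%:E - \int[P]_(w in A') (phin (beta t w))%:E)%E.
    by apply: integralB_EFin => //; exact: iA'.
  rewrite hp// hn// -integralB_EFin//; try exact: iA'.
  apply: eq_integral => w _ /=; rewrite -EFinB; congr EFin.
  by rewrite /gp /gn; have [h|h] := leP (g (beta u w)) 0; have [h'|h'] := leP (- g (beta u w)) 0; lra.
Qed.

Lemma markov_condexp_eq (g : R -> R) : measurable_fun setT g ->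
  P.-integrable setT (EFin \o (g \o beta u)) ->
  {ae P, forall w, condexp P (usual_filtration P F t) (g \o beta u) w =
                   condexp P (g_sigma_algebra_preimage (beta t)) (g \o beta u) w}.
Proof.
move=> mg ig; have [Y hY] := markov_condexp mg ig.
have sF : sigma_algebra setT (usual_filtration P F t) by exact: smallest_sigma_algebra.
have sb := sigma_algebra_preimage_RV (beta t).
have mb := sub_preimage_measurable (mbeta t0).
have cF := condexpP sF usual_filtration_measurable ig.
have cb := condexpP sb mb ig.
have YF := hY _ sub_usual_filtration (@subset_refl _ _).
have Yb := hY _ (@subset_refl _ _) sub_usual_filtration.
apply: filterS2 (is_condexp_unique sF usual_filtration_measurable cF YF)
  (is_condexp_unique sb mb cb Yb) => w -> ->.
by [].
Qed.

End information_markov.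

Theorem theorem6p1 (R : realType) (d : measure_display) (T : measurableType d)
    (P : probability T R) (hP : measure_is_complete P)
    (W : R -> T -> R) (hW : standard_brownian_motion P W)
    (tau : {RV P >-> R}) (htau : forall w, 0 < tau w)
    (hind : independent_systems P
              (g_sigma_algebra_preimage tau) (sigma_process `[0, +oo[ W))
    (hstop : ~ stopping_time (completed_filtration P (natural_filtration W)) tau) :
  let beta := information_process W tau in
  let F_beta := usual_filtration P (natural_filtration beta) in
  forall (t u : R) (g : R -> R),
    0 <= t -> t < u ->
    measurable_fun setT g ->
    P.-integrable setT (EFin \o (g \o beta u)) ->
    {ae P, forall w, condexp P (F_beta t) (g \o beta u) w =
                     condexp P (g_sigma_algebra_preimage (beta t)) (g \o beta u) w}.
Proof.
move=> beta F_beta t u g t0 tu mg ig.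
have mtau : measurable_fun setT tau by exact: measurable_funPT.
exact: (markov_condexp_eq hW mtau htau hind t0 tu hP mg ig).
Qed.
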